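(* For Lebesgue almost every $x>1$, the sequence $(\{x^n\})_{n=1}^{\infty}$ has Poissonian pair correlations.
   Context: $\{y\}$ denotes the fractional part of $y$ and $\|y\|$ the distance from $y$ to the nearest integer. A sequence $(x_n)_{n\ge1}$ in $[0,1]$ has Poissonian pair correlations if for every $s>0$, $$\lim_{N\to\infty}\frac{\#\{(m,n):1\le m, n\le N,\ m\ne n,\ \|x_n-x_m\|\le s/N\}}{N}=2s.$$ *)

(* Defs.v *)
From mathcomp Require Import all_boot all_order all_algebra.
From mathcomp Require Import all_classical all_reals all_analysis.
Set Implicit Arguments.
Unset Strict Implicit.
Unset Printing Implicit Defensive.
Import Order.TTheory GRing.Theory Num.Theory.
Import numFieldNormedType.Exports.
Local Open Scope classical_set_scope.
Local Open Scope ring_scope.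

Definition frac_part (R : realType) (y : R) : R := y - (Num.floor y)%:~R.

Definition dist_int (R : realType) (y : R) : R :=
  inf (range (fun m : int => `|y - m%:~R|)).

(* Sequences are indexed from 1: the term [x 0] plays no role, and the ordinal
   [i : 'I_N] stands for the index [i.+1] in {1, ..., N}. *)
Definition close_pairs (R : realType) (x : nat -> R) (s : R) (N : nat) : nat :=
  #|[pred p : 'I_N * 'I_N |
      (p.1 != p.2) && (dist_int (x p.2.+1 - x p.1.+1) <= s / N%:R)]|.

Definition poissonian_pair_correlations (R : realType) (x : nat -> R) : Prop :=
  (forall n : nat, (1 <= n)%N -> 0 <= x n <= 1) /\
  forall s : R, 0 < s ->
    (close_pairs x s N)%:R / N%:R @[N --> \oo] --> 2 * s.

(* Main.v *)
(** Second moment method.  Fix [1 < a < b] and replace the indicator of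
    [||y|| <= s / N] by a 1-periodic C^1 bump [v] of mean [mu ~ 2 s / N]; let
    [W] be the (bounded, periodic) primitive of [v - mu].  For [m < n] put
    [phi x = x ^ n - x ^ m], whose derivative is exponentially large in [n].
    Then [(v (phi) - mu) G] is the derivative of [W (phi) G / phi'] up to
    [W (phi) (G / phi')'], so its integral over [[a, b]] is exponentially small
    as soon as [G] varies much more slowly than [phi], for instance if [G] is
    the bump of a phase with top exponent at most [n - L].  Hence the row sums
    [S_n = \sum_(m < n) (v (x ^ n - x ^ m) - mu)] are nearly orthogonal when
    their indices differ by at least [L].  For the remaining pairs Cauchy-Schwarz
    reduces to [\int S_n ^ 2], where [v (x ^ n - x ^ m) v (x ^ n - x ^ m')] is
    dominated by a product of the bump of [x ^ n - x ^ m] and a wider bump of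
    [x ^ m' - x ^ m], again nearly orthogonal.  With [N = k ^ 6] and [L = k] the
    variance of the normalized smooth pair count is [O (k ^ -2)], which is
    summable, so the count converges almost everywhere along sixth powers.
    Monotonicity in [N] and in [s] then gives the full limit. *)
Require Import Defs.
From mathcomp Require Import all_boot all_order all_algebra.
From mathcomp Require Import all_classical all_reals all_analysis.
From mathcomp Require Import ring lra zify.
Import Order.TTheory GRing.Theory Num.Theory.
Import numFieldNormedType.Exports.
Local Open Scope classical_set_scope.
Local Open Scope ring_scope.
Set Implicit Arguments.
Unset Strict Implicit.
Unset Printing Implicit Defensive.

(** * Differentiation rules for real functions in pointwise form *)

Section RealDerivatives.
Context {R : realType}.
Implicit Types (f g : R -> R) (x c : R).

Lemma is_derive_add f g x df dg : is_derive x 1 f df -> is_derive x 1 g dg ->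
  is_derive x 1 (fun y => f y + g y) (df + dg).
Proof. exact: is_deriveD. Qed.

Lemma is_derive_sub f g x df dg : is_derive x 1 f df -> is_derive x 1 g dg ->
  is_derive x 1 (fun y => f y - g y) (df - dg).
Proof. exact: is_deriveB. Qed.

Lemma is_derive_scale c f x df : is_derive x 1 f df ->
  is_derive x 1 (fun y => c * f y) (c * df).
Proof. exact: is_deriveZ. Qed.

Lemma is_derive_mul f g x df dg : is_derive x 1 f df -> is_derive x 1 g dg ->
  is_derive x 1 (fun y => f y * g y) (f x * dg + g x * df).
Proof. exact: is_deriveM. Qed.

Lemma is_derive_pow n x : is_derive x 1 (fun y => y ^+ n.+1) (n.+1%:R * x ^+ n).
Proof.
have := is_deriveX n.+1 (is_derive_id x (1 : R)).
by rewrite /GRing.scale /= mulr1 exprfctE.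
Qed.

Lemma is_derive_inv f x df : f x != 0 -> is_derive x 1 f df ->
  is_derive x 1 (fun y => (f y)^-1) (- df / f x ^+ 2).
Proof.
move=> fx0 dfx; have := is_deriveV fx0 dfx.
by rewrite /GRing.scale /= => H; apply: (is_derive_eq H); rewrite mulrC !mulrN mulNr.
Qed.

Lemma is_derive_affine c d x : is_derive x 1 (fun y => (y + c) / d) d^-1.
Proof.
rewrite (_ : (fun y => _) = fun y => d^-1 * (y + c)).
  have H := is_derive_add (is_derive_id x (1:R)) (is_derive_cst c x 1).
  by apply: (is_derive_eq (is_derive_scale d^-1 H)); rewrite addr0 mulr1.
by apply/funext => y; rewrite mulrC.
Qed.

Lemma is_derive_continuous f x df : is_derive x 1 f df -> {for x, continuous f}.
Proof.
by move=> d; apply/differentiable_continuous/derivable1_diffP; apply: ex_derive.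
Qed.

End RealDerivatives.

(** * Integrals over a compact segment *)

Section IntegralOnSegment.
Context {R : realType}.
Variables a b : R.
Hypothesis ab : a < b.

Definition segint (f : R -> R) : R := \int[lebesgue_measure]_(x in `[a, b]) f x.

Lemma segment_integrable (f : R -> R) :
  (forall x : R, a <= x <= b -> {for x, continuous f}) ->
  lebesgue_measure.-integrable `[a, b] (EFin \o f).
Proof.
move=> cf; apply: continuous_compact_integrable; first exact: segment_compact.
apply: continuous_in_subspaceT => x; rewrite inE /= in_itv /=; exact: cf.
Qed.

Lemma segint_cst (c : R) : segint (fun=> c) = c * (b - a).
Proof.
rewrite /segint Rintegral_cst//; congr (_ * _).
rewrite -[RHS]/(fine (b - a)%:E); congr fine.
by have := @lebesgue_measure_itv R `[a, b]%R; rewrite /= lte_fin ab; apply.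
Qed.

Lemma segintD (f g : R -> R) : continuous f -> continuous g ->
  segint (fun x => f x + g x) = segint f + segint g.
Proof. by move=> cf cg; rewrite /segint RintegralD//; apply: segment_integrable => x _; [exact: cf|exact: cg]. Qed.

Lemma segintZ (c : R) (f : R -> R) : continuous f ->
  segint (fun x => c * f x) = c * segint f.
Proof. by move=> cf; rewrite /segint RintegralZl//; apply: segment_integrable => x _; exact: cf. Qed.

Lemma le_segint (f g : R -> R) : continuous f -> continuous g ->
  (forall x, a <= x <= b -> f x <= g x) -> segint f <= segint g.
Proof.
move=> cf cg fg; apply: le_Rintegral => //; try by apply: segment_integrable => x _; (exact: cf || exact: cg).
Qed.

Lemma segint_ge0 (f : R -> R) :
  (forall x, a <= x <= b -> 0 <= f x) -> 0 <= segint f.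
Proof. by move=> f0; apply: Rintegral_ge0 => x /=; rewrite in_itv /=; exact: f0. Qed.

Lemma continuous_bigsum (I : Type) (r : seq I) (P : pred I) (F : I -> R -> R) :
  (forall i, continuous (F i)) ->
  continuous (fun x => \sum_(i <- r | P i) F i x).
Proof.
move=> cF; elim: r => [|i r IH].
  by under eq_fun do rewrite big_nil; move=> x; apply: cvg_cst.
case: (boolP (P i)) => Pi; last by under eq_fun do rewrite big_cons (negbTE Pi).
under eq_fun do rewrite big_cons Pi.
by move=> x; apply: cvgD; [exact: cF|exact: IH].
Qed.

Lemma segint_sum (I : Type) (r : seq I) (P : pred I) (F : I -> R -> R) :
  (forall i, continuous (F i)) ->
  segint (fun x => \sum_(i <- r | P i) F i x) = \sum_(i <- r | P i) segint (F i).
Proof.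
move=> cF; elim: r => [|i r IH].
  under eq_fun do rewrite big_nil.
  by rewrite big_nil segint_cst mul0r.
rewrite big_cons; case: (boolP (P i)) => Pi; last first.
  by under eq_fun do rewrite big_cons (negbTE Pi).
under eq_fun do rewrite big_cons Pi.
rewrite segintD// ?IH//.
exact: continuous_bigsum.
Qed.

(** The fundamental theorem of calculus turns [segint h] into [F b - F a] minus the integral of [e].
    This is the form in which integration by parts is used. The hypotheses are confined to the
    segment because [F] will contain the inverse of a derivative that is controlled only there. *)
Lemma segint_derive_bound (F h e : R -> R) (A M : R) :
  (forall x, a <= x <= b -> is_derive x 1 F (h x + e x)) ->
  (forall x, a <= x <= b -> {for x, continuous h}) ->
  (forall x, a <= x <= b -> {for x, continuous e}) ->
  `|F a| <= A -> `|F b| <= A ->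
  (forall x, a <= x <= b -> `|e x| <= M) ->
  `|segint h| <= A *+ 2 + M * (b - a).
Proof.
move=> dF ch ce Fa Fb eM.
have ih := segment_integrable ch; have ie := segment_integrable ce.
have dcF x : a <= x <= b -> {for x, continuous F}.
  move=> xab; have d := dF x xab.
  by apply/differentiable_continuous/derivable1_diffP; apply: ex_derive.
have itvW x : x \in `]a, b[ -> a <= x <= b.
  by rewrite in_itv /= => /andP[/ltW -> /ltW ->].
have : segint (fun x => h x + e x) = F b - F a.
  rewrite /segint /Rintegral (@continuous_FTC2 _ _ F)//.
  - apply: continuous_in_subspaceT => x; rewrite inE /= in_itv /= => xab.
    by apply: cvgD; [exact: ch|exact: ce].
  - split.
    + by move=> x /itvW xab; have d := dF x xab; apply: ex_derive.
    + by apply: cvg_at_right_filter; apply: dcF; rewrite lexx ltW.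
    + by apply: cvg_at_left_filter; apply: dcF; rewrite lexx ltW.
  - by move=> x /itvW xab; have d := dF x xab; rewrite derive1E derive_val.
rewrite /segint RintegralD// -/(segint h) -/(segint e) => /eqP.
rewrite -subr_eq0 => /eqP E.
have -> : segint h = F b - F a - segint e by lra.
have eI : `|segint e| <= M * (b - a).
  apply: (le_trans (le_normr_Rintegral _ ie)) => //.
  rewrite -segint_cst; apply: le_Rintegral => //.
  - exact: (integrable_norm ie).
  - by apply: segment_integrable => x _; apply: cvg_cst.
have t1 := ler_normB (F b - F a) (segint e); have t2 := ler_normB (F b) (F a).
rewrite mulr2n. lra.
Qed.

End IntegralOnSegment.

(** * A C^1 smoothing of the step function *)

Section Spline.
Context {R : realType}.
Implicit Types t : R.

Definition pos_part t : R := Num.max 0 t.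

Lemma pos_partE t : pos_part t = (t + `|t|) / 2.
Proof.
rewrite /pos_part; have [t0|t0] := leP 0 t.
  by rewrite ger0_norm//; lra.
by rewrite ltr0_norm//; lra.
Qed.

Lemma pos_part_continuous : continuous pos_part.
Proof.
rewrite (_ : pos_part = fun t => (t + `|t|) / 2); last by apply/funext/pos_partE.
move=> t; apply: cvgM; last exact: cvg_cst.
by apply: cvgD; [exact: cvg_id|exact: norm_continuous].
Qed.

Lemma is_derive_pos_part_exp n t :
  is_derive t 1 (fun u : R => pos_part u ^+ n.+2) (n.+2%:R * pos_part t ^+ n.+1).
Proof.
have [t0|t0|->] := ltgtP t 0.
- rewrite {2}/pos_part max_l ?ltW// expr0n mulr0.
  apply: (@near_eq_is_derive R R^o R^o (cst 0)).
  near=> u; rewrite /pos_part max_l ?expr0n//; apply/ltW; near: u; exact: lt_nbhsl.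
- rewrite {2}/pos_part max_r ?ltW//.
  apply: (@near_eq_is_derive R R^o R^o (fun u : R => u ^+ n.+2)).
    near=> u; rewrite /pos_part max_r//; apply/ltW; near: u; exact: lt_nbhsr.
  exact: is_derive_pow.
- rewrite {2}/pos_part maxxx expr0n mulr0.
  (* At the corner the difference quotient is [pos_part h ^+ n.+1] on both sides: it is [h ^+ n.+1]
     for positive [h] and vanishes for negative [h]. *)
  have H : h^-1 *: (((fun u : R => pos_part u ^+ n.+2) \o shift 0) (h *: 1) -
     (fun u : R => pos_part u ^+ n.+2) 0) @[h --> 0^'] --> (0 : R).
    apply: (@cvg_trans _ (pos_part h ^+ n.+1 @[h --> (0:R)^'])).
      refine (@near_eq_cvg R R (0:R)^' _ (fun h => pos_part h ^+ n.+1) _ _); near=> h.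
      have h0 : h != 0 by near: h; exact: nbhs_dnbhs_neq.
      rewrite /= /shift /= addr0 /GRing.scale /= mulr1 {3}/pos_part maxxx.
      rewrite (expr0n _ n.+2) subr0 /pos_part; have [hp|hn] := leP 0 h.
        by rewrite [in RHS]exprS mulKf.
      by rewrite !expr0n mulr0.
    apply: cvg_within_filter.
    have E0 : pos_part (0 : R) ^+ n.+1 = 0 by rewrite /pos_part maxxx expr0n.
    have c0 : pos_part h @[h --> (0 : R)] --> pos_part 0 := @pos_part_continuous 0.
    have c : pos_part h ^+ n.+1 @[h --> (0 : R)] --> pos_part (0 : R) ^+ n.+1.
      exact: (continuous_cvg _ (@exprn_continuous R n.+1 (pos_part 0)) c0).
    by rewrite E0 in c.
  by apply: DeriveDef; [exact: cvgP H|exact: cvg_lim H].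
Unshelve. all: by end_near. Qed.

(* Quadratic spline smoothing of the Heaviside function, obtained from
   [pos_part ^ 2] by a second difference; [step_prim] is its primitive. *)
Definition spline (F : R -> R) (t : R) : R := 2 * F t - 4 * F (t - 1 / 2) + 2 * F (t - 1).

Definition step := spline (fun t => pos_part t ^+ 2).
Definition step_deriv := spline (fun t => 2 * pos_part t).
Definition step_prim := spline (fun t => pos_part t ^+ 3 / 3).

Lemma is_derive_spline (F f : R -> R) t : (forall u : R, is_derive u 1 F (f u)) ->
  is_derive t 1 (spline F) (spline f t).
Proof.
move=> dF.
have H c : is_derive t 1 (fun u => F (u - c)) (f (t - c)).
  have d := is_derive_sub (is_derive_id t (1 : R)) (is_derive_cst c t (1 : R)).
  have e := @is_derive1_comp _ F _ t _ _ (dF (t - c)) d.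
  by rewrite subr0 mulr1 in e; exact: e.
exact: (is_derive_add (is_derive_sub (is_derive_scale 2 (dF t))
  (is_derive_scale 4 (H (1 / 2)))) (is_derive_scale 2 (H 1))).
Qed.

Lemma is_derive_step t : is_derive t 1 step (step_deriv t).
Proof. by apply: is_derive_spline => u; apply: is_derive_pos_part_exp. Qed.

Lemma is_derive_step_prim t : is_derive t 1 step_prim (step t).
Proof.
apply: is_derive_spline => u.
rewrite (_ : (fun u => _) = fun u => 3^-1 * pos_part u ^+ 3); last first.
  by apply/funext => v; rewrite mulrC.
apply: (is_derive_eq (is_derive_scale _ (is_derive_pos_part_exp 1 u))).
by rewrite mulrA mulVf ?mul1r.
Qed.

Lemma step_deriv_continuous : continuous step_deriv.
Proof.
have H c : continuous (fun t => 2 * pos_part (t - c)).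
  move=> t; apply: cvgM; first exact: cvg_cst.
  apply: (@continuous_comp R R R (fun t => t - c) pos_part); last exact: pos_part_continuous.
  by apply: cvgB; [exact: cvg_id|exact: cvg_cst].
move=> t; apply: cvgD; first apply: cvgB.
- apply: cvgM; first exact: cvg_cst.
  by apply: cvgM; [exact: cvg_cst|exact: pos_part_continuous].
- by apply: cvgM; [exact: cvg_cst|exact: H].
- by apply: cvgM; [exact: cvg_cst|exact: H].
Qed.

Lemma step_le0 t : t <= 0 -> [/\ step t = 0, step_deriv t = 0 & step_prim t = 0].
Proof.
move=> t0; rewrite /step /step_deriv /step_prim /spline /pos_part.
rewrite !max_l; [|lra..].
by rewrite !expr0n /=; split; lra.
Qed.

(** The shift [1 / 2] in the primitive is the area lost on the ramp, which is symmetric about its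
    midpoint. *)
Lemma step_ge1 t : 1 <= t -> [/\ step t = 1, step_deriv t = 0 & step_prim t = t - 1 / 2].
Proof.
move=> t1; rewrite /step /step_deriv /step_prim /spline /pos_part.
rewrite !max_r; [|lra..].
by split; field.
Qed.

Lemma step_bounds t : [/\ 0 <= step t <= 1, 0 <= step_deriv t <= 2 &
  0 <= step_prim t <= pos_part t].
Proof.
have [t0|t0] := leP t 0.
  by have [-> -> ->] := step_le0 t0; rewrite !lexx ler01 /= /pos_part le_max lexx; split; rewrite ?ler0n.
have [t1|t1] := leP 1 t.
  have [-> -> ->] := step_ge1 t1; rewrite /pos_part max_r; last by lra.
  by split; lra.
rewrite /step /step_deriv /step_prim /spline /pos_part.
rewrite (@max_r _ _ 0 t (ltW t0)) (@max_l _ _ 0 (t - 1)); last by lra.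
have [h|h] := leP t (1 / 2).
  rewrite (@max_l _ _ 0 (t - 1 / 2)); last by lra.
  rewrite !expr0n /=; split; [nra|lra|].
  have : 0 <= t ^+ 3 <= t by rewrite exprn_ge0 ?ltW//= !exprS expr0; nra.
  lra.
rewrite (@max_r _ _ 0 (t - 1 / 2)); last by lra.
rewrite !expr0n /=; split; [nra|lra|].
have [u0 u1] : 0 <= t - 1 / 2 /\ t - 1 / 2 <= 1 / 2 by split; lra.
(* Expanding the cubic around [1], the end of the ramp, leaves [t - 1 / 2] plus two thirds of
   [(1 - t) ^+ 3], a term between [0] and [1 / 12]. *)
have -> : 2 * (t ^+ 3 / 3) - 4 * ((t - 1 / 2) ^+ 3 / 3) + 2 * (0 / 3) =
  t - 1 / 2 - 2 / 3 * (t - 1) ^+ 3 by field.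
have [c0 c1] : 0 <= 1 - t /\ 1 - t <= 1 / 2 by split; lra.
have -> : (t - 1) ^+ 3 = - (1 - t) ^+ 3 by ring.
have h0 : 0 <= (1 - t) ^+ 3 by rewrite exprn_ge0.
have h1 : (1 - t) ^+ 3 <= (1 / 2) ^+ 3 by rewrite lerXn2r // nnegrE //; lra.
have h2 : (1 / 2) ^+ 3 = 1 / 8 :> R by field.
rewrite h2 in h1; move: ((1 - t) ^+ 3) h0 h1 => y h0 h1; lra.
Qed.

End Spline.

(** * The periodic bump, its derivative and its centred primitive *)

Section PeriodicBump.
Context {R : realType}.
Implicit Types e f t y : R.

(** The difference of two ramps, climbing over [[-f, -e]] and over [[e, f]]: a plateau of height [1]
    on [[-e, e]], supported in [[-f, f]], with integral [e + f]. Writing [t + - e] gives both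
    arguments the shape [(t + c) / (f - e)], so that one computation serves for both. *)
Definition bump0 e f t := step ((t + f) / (f - e)) - step ((t + - e) / (f - e)).
Definition bump0_deriv e f t :=
  step_deriv ((t + f) / (f - e)) / (f - e) - step_deriv ((t + - e) / (f - e)) / (f - e).
(* The constants are chosen so that [bump0_prim] takes equal values at [t] and
   [t - 1] for [t] near [1 / 2], hence [bump_prim] below is C^1. *)
Definition bump0_prim e f t :=
  (f - e) * (step_prim ((t + f) / (f - e)) - step_prim ((t + - e) / (f - e))) -
  (e + f) / 2 - (e + f) * t.

(** Subtracting this integer moves [y] into [[-1/2, 1/2)], which makes the functions below
    1-periodic. *)
Definition nint y : int := Num.floor (y + 1 / 2).

Definition bump e f y := bump0 e f (y - (nint y)%:~R).
Definition bump_deriv e f y := bump0_deriv e f (y - (nint y)%:~R).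
Definition bump_prim e f y := bump0_prim e f (y - (nint y)%:~R).

Lemma nintP y : - (1 / 2) <= y - (nint y)%:~R < 1 / 2.
Proof.
rewrite /nint; have := floor_le (y + 1 / 2); have := floorD1_gt (y + 1 / 2).
by rewrite intrD; lra.
Qed.

Variables e f : R.
Hypotheses (e0 : 0 < e) (ef : e < f) (f4 : f < 1 / 4).

Ltac slra := have := e0; have := ef; have := f4; lra.

Let d0 : 0 < f - e. Proof. by rewrite subr_gt0. Qed.
Let dn0 : f - e != 0. Proof. by rewrite gt_eqF. Qed.

Lemma bump0_out t : f <= `|t| -> bump0 e f t = 0 /\ bump0_deriv e f t = 0.
Proof.
rewrite ler_normr /bump0 /bump0_deriv => /orP[ft|ft].
  have h1 : 1 <= (t + f) / (f - e). rewrite ler_pdivlMr //. slra.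
  have h2 : 1 <= (t + - e) / (f - e) by rewrite ler_pdivlMr //; slra.
  have [-> -> _] := step_ge1 h1; have [-> -> _] := step_ge1 h2.
  by rewrite mul0r !subrr.
have h1 : (t + f) / (f - e) <= 0 by rewrite ler_pdivrMr // mul0r; slra.
have h2 : (t + - e) / (f - e) <= 0 by rewrite ler_pdivrMr // mul0r; slra.
have [-> -> _] := step_le0 h1; have [-> -> _] := step_le0 h2.
by rewrite mul0r !subrr.
Qed.

Lemma bump0_prim_right t : f <= t -> bump0_prim e f t = (e + f) / 2 - (e + f) * t.
Proof.
move=> ft; rewrite /bump0_prim.
have h1 : 1 <= (t + f) / (f - e) by rewrite ler_pdivlMr //; slra.
have h2 : 1 <= (t + - e) / (f - e) by rewrite ler_pdivlMr //; slra.
have [_ _ ->] := step_ge1 h1; have [_ _ ->] := step_ge1 h2.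
by field.
Qed.

Lemma bump0_prim_left t : t <= - f -> bump0_prim e f t = - (e + f) / 2 - (e + f) * t.
Proof.
move=> ft; rewrite /bump0_prim.
have h1 : (t + f) / (f - e) <= 0 by rewrite ler_pdivrMr // mul0r; slra.
have h2 : (t + - e) / (f - e) <= 0 by rewrite ler_pdivrMr // mul0r; slra.
have [_ _ ->] := step_le0 h1; have [_ _ ->] := step_le0 h2.
by rewrite subrr mulr0; field.
Qed.

Lemma bump0_in t : `|t| <= e -> bump0 e f t = 1.
Proof.
rewrite ler_norml /bump0 => /andP[te1 te2].
have h1 : 1 <= (t + f) / (f - e) by rewrite ler_pdivlMr //; slra.
have h2 : (t + - e) / (f - e) <= 0 by rewrite ler_pdivrMr // mul0r; slra.
have [-> _ _] := step_ge1 h1; have [-> _ _] := step_le0 h2.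
by rewrite subr0.
Qed.

Lemma bump0_bounds t : 0 <= bump0 e f t <= 1.
Proof.
rewrite /bump0; have [te|te] := leP t e.
  have h2 : (t + - e) / (f - e) <= 0 by rewrite ler_pdivrMr // mul0r; slra.
  have [-> _ _] := step_le0 h2; rewrite subr0.
  by have [] := step_bounds ((t + f) / (f - e)).
have h1 : 1 <= (t + f) / (f - e) by rewrite ler_pdivlMr //; slra.
have [-> _ _] := step_ge1 h1.
have [] := step_bounds ((t + - e) / (f - e)); slra.
Qed.

Lemma bump0_deriv_bound t : `|bump0_deriv e f t| <= 2 / (f - e).
Proof.
rewrite /bump0_deriv -mulrBl normrM (gtr0_norm (x := (f - e)^-1)) ?invr_gt0 //.
rewrite ler_wpM2r ?invr_ge0 ?(ltW d0) // ler_norml.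
have [_ + _] := step_bounds ((t + f) / (f - e)).
have [_ + _] := step_bounds ((t + - e) / (f - e)).
slra.
Qed.

Lemma bump0_prim_bound t : `|t| <= 1 / 2 -> `|bump0_prim e f t| <= 2.
Proof.
rewrite ler_norml => /andP[t1 t2]; rewrite /bump0_prim.
(* Since [step_prim] is below the positive part, the factor [f - e] cancels and leaves at most the
   positive part of [t + c], hence at most [1 / 2 + 1 / 4]. The bound does not degrade as the bump
   narrows. *)
have H c : `|c| <= 1 / 4 -> 0 <= (f - e) * step_prim ((t + c) / (f - e)) <= 3 / 4.
  rewrite ler_norml => /andP[c1 c2].
  have [_ _ /andP[s0 s1]] := step_bounds ((t + c) / (f - e)).
  rewrite mulr_ge0 ?(ltW d0) //=.
  apply: (le_trans (ler_wpM2l (ltW d0) s1)).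
  rewrite /pos_part; have [h|h] := leP 0 ((t + c) / (f - e)).
    by rewrite mulrC divfK //; slra.
  by rewrite mulr0; slra.
have /andP[h1 h2] : 0 <= (f - e) * step_prim ((t + f) / (f - e)) <= 3 / 4.
  by apply: H; rewrite ler_norml; slra.
have /andP[h3 h4] : 0 <= (f - e) * step_prim ((t + - e) / (f - e)) <= 3 / 4.
  by apply: H; rewrite ler_norml; slra.
rewrite mulrBr ler_norml.
move: ((f - e) * _) h1 h2 ((f - e) * _) h3 h4 => A h1 h2 B h3 h4.
have : - (1 / 4) <= (e + f) * t <= 1 / 4 by have := e0; have := ef; have := f4; nra.
slra.
Qed.

Lemma is_derive_bump0 t : is_derive t 1 (bump0 e f) (bump0_deriv e f t).
Proof.
have H c : is_derive t 1 (fun u => step ((u + c) / (f - e)))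
    (step_deriv ((t + c) / (f - e)) / (f - e)).
  exact: (@is_derive1_comp _ step _ t _ _ (is_derive_step _) (is_derive_affine c (f - e) t)).
exact: (is_derive_sub (H f) (H (- e))).
Qed.

Lemma is_derive_bump0_prim t :
  is_derive t 1 (bump0_prim e f) (bump0 e f t - (e + f)).
Proof.
have H c : is_derive t 1 (fun u => step_prim ((u + c) / (f - e)))
    (step ((t + c) / (f - e)) / (f - e)).
  exact: (@is_derive1_comp _ step_prim _ t _ _ (is_derive_step_prim _)
    (is_derive_affine c (f - e) t)).
have K := is_derive_sub (is_derive_sub
  (is_derive_scale (f - e) (is_derive_sub (H f) (H (- e))))
  (is_derive_cst ((e + f) / 2) t (1 : R)))
  (is_derive_scale (e + f) (is_derive_id t (1 : R))).
apply: (is_derive_eq K); rewrite /bump0; field.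
by rewrite subr_eq0 gt_eqF.
Qed.

Lemma bump0_deriv_continuous : continuous (bump0_deriv e f).
Proof.
have H (c : R) : continuous (fun u : R => step_deriv ((u + c) / (f - e)) / (f - e)).
  move=> t; apply: cvgM; last exact: cvg_cst.
  apply: (@continuous_comp R R R (fun u => (u + c) / (f - e)) step_deriv).
    exact: is_derive_continuous (is_derive_affine c (f - e) t).
  exact: step_deriv_continuous.
by move=> t; apply: cvgB; apply: H.
Qed.

(** Any integer [q] in this range can replace [nint y], so near a given point the three functions
    are translates of fixed differentiable or continuous ones. If [q] is not [nint y], then [y] lies
    outside the supports around both integers, where the bumps vanish and the affine branches of the
    primitive match. *)
Lemma bump_local (q : int) y : `|y - q%:~R| < 1 - f ->
  [/\ bump e f y = bump0 e f (y - q%:~R),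
      bump_deriv e f y = bump0_deriv e f (y - q%:~R) &
      bump_prim e f y = bump0_prim e f (y - q%:~R)].
Proof.
rewrite /bump /bump_deriv /bump_prim ltr_norml => /andP[q1 q2].
have /andP[p1 p2] := nintP y; set p := nint y in p1 p2 *.
have [->//|/eqP pq] := eqVneq p q.
(* The two integers differ by less than [1 / 2 + (1 - f)], plus at most nothing else, hence by less
   than [2]. *)
have [lpq|lqp] : p = q + 1 \/ p = q - 1.
  have : p%:~R < (q + 2)%:~R :> R by rewrite intrD; slra.
  have : (q - 2)%:~R < p%:~R :> R by rewrite intrB; slra.
  rewrite !ltr_int; lia.
- have E : p%:~R = q%:~R + 1 :> R by rewrite lpq intrD.
  have [-> ->] : bump0 e f (y - p%:~R) = 0 /\ bump0_deriv e f (y - p%:~R) = 0.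
    by apply: bump0_out; rewrite ler_normr; slra.
  have [-> ->] : bump0 e f (y - q%:~R) = 0 /\ bump0_deriv e f (y - q%:~R) = 0.
    by apply: bump0_out; rewrite ler_normr; slra.
  split => //; rewrite bump0_prim_left ?bump0_prim_right; [|slra..].
  by rewrite E; field.
- have E : p%:~R = q%:~R - 1 :> R by rewrite lqp intrB.
  have [-> ->] : bump0 e f (y - p%:~R) = 0 /\ bump0_deriv e f (y - p%:~R) = 0.
    by apply: bump0_out; rewrite ler_normr; slra.
  have [-> ->] : bump0 e f (y - q%:~R) = 0 /\ bump0_deriv e f (y - q%:~R) = 0.
    by apply: bump0_out; rewrite ler_normr; slra.
  split => //; rewrite bump0_prim_right ?bump0_prim_left; [|slra..].
  by rewrite E; field.
Qed.

Lemma near_nint y : \forall z \near y, `|z - (nint y)%:~R| < 1 - f.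
Proof.
have /andP[p1 p2] := nintP y.
have g0 : 0 < 1 / 4 :> R by slra.
near=> z.
have : `|y - z| < 1 / 4 by near: z; exact: (@cvgr_dist_lt _ R^o _ _ _ id).
rewrite !ltr_norml; slra.
Unshelve. all: by end_near. Qed.

Lemma is_derive_shifted (F : R -> R) (m y df : R) :
  is_derive (y - m) 1 F df -> is_derive y 1 (fun z => F (z - m)) df.
Proof.
move=> dF; have d := is_derive_sub (is_derive_id y (1 : R)) (is_derive_cst m y (1 : R)).
have E := @is_derive1_comp _ F _ y _ _ dF d.
by rewrite subr0 mulr1 in E; exact: E.
Qed.

Lemma is_derive_bump y : is_derive y 1 (bump e f) (bump_deriv e f y).
Proof.
refine (@near_eq_is_derive R R^o R^o (fun z => bump0 e f (z - (nint y)%:~R)) _ y 1 _ _ _).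
  by near=> z; have [|-> //] := @bump_local (nint y) z; near: z; exact: near_nint.
apply: is_derive_shifted; exact: is_derive_bump0.
Unshelve. all: by end_near. Qed.

Lemma is_derive_bump_prim y : is_derive y 1 (bump_prim e f) (bump e f y - (e + f)).
Proof.
refine (@near_eq_is_derive R R^o R^o (fun z => bump0_prim e f (z - (nint y)%:~R)) _ y 1 _ _ _).
  by near=> z; have [|_ _ ->//] := @bump_local (nint y) z; near: z; exact: near_nint.
apply: is_derive_shifted; exact: is_derive_bump0_prim.
Unshelve. all: by end_near. Qed.

Lemma bump_deriv_continuous : continuous (bump_deriv e f).
Proof.
move=> y.
have c : (fun z => bump0_deriv e f (z - (nint y)%:~R)) z @[z --> y] --> bump_deriv e f y.
  apply: (@continuous_comp R R R (fun z => z - (nint y)%:~R) (bump0_deriv e f)).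
    by apply: cvgB; [exact: cvg_id|exact: cvg_cst].
  exact: bump0_deriv_continuous.
apply: cvg_trans c; apply: near_eq_cvg.
by near=> z; have [|_ -> _ //] := @bump_local (nint y) z; near: z; exact: near_nint.
Unshelve. all: by end_near. Qed.

Lemma bump_continuous : continuous (bump e f).
Proof. by move=> y; apply: is_derive_continuous (is_derive_bump y). Qed.

Lemma bump_bounds y : 0 <= bump e f y <= 1.
Proof. exact: bump0_bounds. Qed.

Lemma bump_deriv_bound y : `|bump_deriv e f y| <= 2 / (f - e).
Proof. exact: bump0_deriv_bound. Qed.

Lemma bump_prim_bound y : `|bump_prim e f y| <= 2.
Proof. apply: bump0_prim_bound; rewrite ler_norml; have := nintP y; slra. Qed.

Lemma bump_eq1 (m : int) y : `|y - m%:~R| <= e -> bump e f y = 1.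
Proof.
move=> ym; have [|-> _ _] := @bump_local m y; last exact: bump0_in.
by apply: (le_lt_trans ym); slra.
Qed.

Lemma bump_neq0 y : bump e f y != 0 -> exists m : int, `|y - m%:~R| <= f.
Proof.
move=> b0; exists (nint y); rewrite leNgt; apply: contra b0 => h.
by rewrite /bump (bump0_out (ltW h)).1.
Qed.

End PeriodicBump.

(* If [y] and [z] are both near integers then so is [y - z]: this bounds the
   correlation of two phases sharing the top exponent [n] by that of [n] with a
   lower phase. *)
Lemma bump_mul_le (R : realType) (e f y z : R) : 0 < e -> e < f -> f < 1 / 12 ->
  bump e f y * bump e f z <= bump e f y * bump (2 * f) (3 * f) (y - z).
Proof.
move=> e0 ef f12; have f4 : f < 1 / 4 by lra.
have /andP[y0 y1] := bump_bounds e0 ef f4 y.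
have /andP[z0 z1] := bump_bounds e0 ef f4 z.
have [->|by0] := eqVneq (bump e f y) 0; first by rewrite !mul0r.
have [->|bz0] := eqVneq (bump e f z) 0.
  rewrite mulr0 mulr_ge0 //.
  suff /andP[] : 0 <= bump (2 * f) (3 * f) (y - z) <= 1 by [].
  by apply: bump_bounds; lra.
apply: ler_wpM2l => //.
have [p hp] := bump_neq0 e0 ef f4 by0; have [q hq] := bump_neq0 e0 ef f4 bz0.
rewrite (@bump_eq1 _ (2 * f) (3 * f) _ _ _ (p - q)) //; try lra.
move: hp hq; rewrite !ler_norml intrB; lra.
Qed.

(** * Derivatives of the phases *)

Section PowerPhase.
Context {R : realType}.
Implicit Types (x : R).

(** The indices are shifted to match the ordinals of [close_pairs]: [n] stands for the exponent
    [n.+1]. *)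
Definition phase (n m : nat) x := x ^+ n.+1 - x ^+ m.+1.
Definition phase_deriv (n m : nat) x := n.+1%:R * x ^+ n - m.+1%:R * x ^+ m.
Definition phase_deriv2 (n m : nat) x :=
  n.+1%:R * (n%:R * x ^+ n.-1) - m.+1%:R * (m%:R * x ^+ m.-1).

Lemma is_derive_phase n m x : is_derive x 1 (phase n m) (phase_deriv n m x).
Proof. exact: (is_derive_sub (is_derive_pow n x) (is_derive_pow m x)). Qed.

Lemma is_derive_phase_deriv n m x :
  is_derive x 1 (phase_deriv n m) (phase_deriv2 n m x).
Proof.
have H k : is_derive x 1 (fun y => k.+1%:R * y ^+ k) (k.+1%:R * (k%:R * x ^+ k.-1)).
  case: k => [|k]; last exact: is_derive_scale (is_derive_pow k x).
  rewrite mul0r mulr0 /=; under eq_fun do rewrite expr0 mulr1.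
  exact: is_derive_cst.
exact: (is_derive_sub (H n) (H m)).
Qed.

Lemma phase_continuous n m : continuous (phase n m).
Proof. by move=> x; apply: is_derive_continuous (is_derive_phase n m x). Qed.

Lemma phase_deriv_continuous n m : continuous (phase_deriv n m).
Proof. by move=> x; apply: is_derive_continuous (is_derive_phase_deriv n m x). Qed.

Lemma phase_deriv2_continuous n m : continuous (phase_deriv2 n m).
Proof.
have H k : continuous (fun y : R => k.+1%:R * (k%:R * y ^+ k.-1)).
  move=> y; do 2 (apply: cvgM; first exact: cvg_cst); exact: exprn_continuous.
by move=> x; apply: cvgB; apply: H.
Qed.

(** As [m < n], the subtracted term is at most [n.+1%:R * x ^+ n.-1]. What remains is at least the
    fraction [(x - 1) / x] of the leading term, and [x >= a]. *)
Lemma phase_deriv_ge n m x a : (m < n)%N -> 1 < a -> a <= x ->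
  n.+1%:R * x ^+ n * ((a - 1) / x) <= phase_deriv n m x.
Proof.
case: n => // n mn a1 ax; rewrite /phase_deriv.
have x1 : 1 < x := lt_le_trans a1 ax.
have x0 : 0 < x by lra.
have h1 : m.+1%:R * x ^+ m <= n.+2%:R * x ^+ n.
  by apply: ler_pM => //; rewrite ?exprn_ge0 ?ler_nat ?ler_eXn2l ?(ltW x0) //; lia.
have -> : n.+2%:R * x ^+ n.+1 * ((a - 1) / x) = n.+2%:R * x ^+ n * (a - 1).
  by rewrite exprS; field; rewrite gt_eqF.
have h2 : 0 <= n.+2%:R * x ^+ n by rewrite mulr_ge0 // exprn_ge0 // ltW.
rewrite exprS mulrCA.
move: (_ * x ^+ n) (_ * x ^+ m) h1 h2 => A B h1 h2; nra.
Qed.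

Lemma phase_deriv_le n m x : 0 <= x -> phase_deriv n m x <= n.+1%:R * x ^+ n.
Proof. by move=> x0; rewrite gerBl mulr_ge0 // exprn_ge0. Qed.

Lemma phase_deriv_ge0 n m x : (m < n)%N -> 1 < x -> 0 <= phase_deriv n m x.
Proof.
move=> mn x1; apply: le_trans (phase_deriv_ge mn x1 (lexx x)).
by rewrite !mulr_ge0 ?exprn_ge0 ?invr_ge0 //; lra.
Qed.

(** Both terms of the second derivative lie between [0] and the right-hand side, so no cancellation
    has to be tracked. *)
Lemma phase_deriv2_bound n m x : (m < n)%N -> 1 < x ->
  `|phase_deriv2 n m x| <= n.+1%:R * (n.+1%:R * x ^+ n).
Proof.
move=> mn x1; have x0 : 0 <= x by lra.
have H k : (k <= n)%N -> 0 <= k.+1%:R * (k%:R * x ^+ k.-1) <= n.+1%:R * (n.+1%:R * x ^+ n).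
  move=> kn; rewrite !mulr_ge0 ?exprn_ge0 //=.
  apply: ler_pM => //; rewrite ?mulr_ge0 ?exprn_ge0 ?ler_nat //.
  by apply: ler_pM; rewrite ?exprn_ge0 ?ler_nat ?ler_eXn2l //; lia.
have := H n (leqnn n); have := H m (ltnW mn); rewrite /phase_deriv2 ler_norml; lra.
Qed.

End PowerPhase.

(** * Near-orthogonality of a fast bump to a slow factor *)

Section Orthogonality.
Context {R : realType}.
Variables a b : R.

(** With [K = b / (a - 1)], a bound for the leading term of [phase_deriv] divided by [phase_deriv],
    the summand [4 * K] comes from the two endpoints and the rest from the error integral. *)
Definition ortho_const : R :=
  4 * (b / (a - 1)) + 2 * (b / (a - 1) + (b / (a - 1)) ^+ 2) * (b - a).

Lemma ortho_const_ge0 : 1 < a -> a < b -> 0 <= ortho_const.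
Proof.
move=> a1 ab; have K0 : 0 <= b / (a - 1) by rewrite divr_ge0 //; lra.
have ba : 0 <= b - a by lra.
by apply: addr_ge0; apply: mulr_ge0 => //; apply: mulr_ge0 => //; rewrite addr_ge0 ?exprn_ge0.
Qed.

(* With [W] the primitive of [bump - mean], the integrand is, up to the small
   term [W(phi) (G / phi')'], the derivative of [W(phi) G / phi']. *)
Lemma bump_phase_orthogonal (e f D : R) (n m l : nat) (G G' : R -> R) :
  1 < a -> a < b -> 0 < e -> e < f -> f < 1 / 4 -> 0 <= D ->
  (m < n)%N -> (l <= n)%N ->
  (forall x : R, is_derive x 1 G (G' x)) -> continuous G' ->
  (forall x, a <= x <= b -> `|G x| <= 1) ->
  (forall x, a <= x <= b -> `|G' x| * x ^+ l <= D * (n.+1%:R * x ^+ n)) ->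
  `|segint a b (fun x => (bump e f (phase n m x) - (e + f)) * G x)|
    <= ortho_const * (1 + D) / a ^+ l.
Proof.
move=> a1 ab e0 ef f4 D0 mn ln dG cG' G1 G'b.
set K := b / (a - 1); set t := a ^+ l.
have t1 : 1 <= t by rewrite exprn_ege1 // ltW.
have t0 : 0 < t by lra.
have K0 : 0 < K by rewrite divr_gt0; lra.
(* [P] is the leading term of [phase_deriv]. On the segment it is at least [n.+1%:R * t] and at most
   [K] times [phase_deriv]. *)
pose P (x : R) := n.+1%:R * x ^+ n.
have Pt x : a <= x <= b -> n.+1%:R * t <= P x.
  move=> /andP[ax xb]; rewrite ler_wpM2l // /t.
  apply: (@le_trans _ _ (x ^+ l)); first by rewrite lerXn2r // nnegrE; lra.
  by rewrite ler_weXn2l //; lra.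
have P0 x : a <= x <= b -> 0 < P x.
  by move=> /Pt; apply: lt_le_trans; rewrite mulr_gt0.
have phiP x : a <= x <= b -> P x / K <= phase_deriv n m x.
  move=> /[dup] /P0 Px /andP[ax xb].
  apply: le_trans (phase_deriv_ge mn a1 ax).
  rewrite -/(P x) ler_wpM2l ?(ltW Px) // /K invf_div ler_wpM2l //; first by lra.
  by rewrite lef_pV2 // posrE; lra.
have phi0 x : a <= x <= b -> 0 < phase_deriv n m x.
  by move=> xab; apply: lt_le_trans (phiP x xab); rewrite divr_gt0 // P0.
have invphi x : a <= x <= b -> (phase_deriv n m x)^-1 <= K / P x.
  move=> xab; rewrite -[K / P x]invrK invf_div lef_pV2 ?posrE ?phi0 ?phiP //.
  by rewrite divr_gt0 // P0.
(* What integration by parts leaves over: the bounded primitive times the derivative of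
   [G / phase_deriv]. *)
pose err (x : R) := bump_prim e f (phase n m x) *
  (G x * (- phase_deriv2 n m x / phase_deriv n m x ^+ 2) + (phase_deriv n m x)^-1 * G' x).
have cG : continuous G by move=> x; apply: is_derive_continuous (dG x).
have cphi x : a <= x <= b -> {for x, continuous (fun y => (phase_deriv n m y)^-1)}.
  by move=> xab; apply: cvgV; [rewrite gt_eqF ?phi0|exact: phase_deriv_continuous].
have cbphi : continuous (fun x => bump e f (phase n m x)).
  move=> x; apply: (@continuous_comp R R R (phase n m) (bump e f)).
    exact: phase_continuous.
  exact: bump_continuous.
have key := @segint_derive_bound R a b ab
  (fun x => bump_prim e f (phase n m x) * (G x * (phase_deriv n m x)^-1))
  (fun x => (bump e f (phase n m x) - (e + f)) * G x) err (2 * (K / t))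
  (2 * (K ^+ 2 / t + D * K / t)).
have bndT x : a <= x <= b ->
    `|bump_prim e f (phase n m x) * (G x * (phase_deriv n m x)^-1)| <= 2 * (K / t).
  move=> xab; rewrite normrM ler_pM //; first exact: bump_prim_bound.
  rewrite normrM -[K / t]mul1r ler_pM // ?G1 //.
  rewrite gtr0_norm ?invr_gt0 ?phi0 //; apply: (le_trans (invphi x xab)).
  rewrite ler_wpM2l ?(ltW K0) // lef_pV2 ?posrE ?P0 //; apply: le_trans (Pt x xab).
  by rewrite ler_peMl ?(ltW t0) // ler1n.
apply: (le_trans (key _ _ _ _ _ _)).
- move=> x xab.
  have d1 := @is_derive1_comp _ (bump_prim e f) (phase n m) x _ _
    (is_derive_bump_prim e0 ef f4 (phase n m x)) (is_derive_phase n m x).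
  have d2 := is_derive_mul (dG x)
    (is_derive_inv (lt0r_neq0 (phi0 x xab)) (is_derive_phase_deriv n m x)).
  apply: (is_derive_eq (is_derive_mul d1 d2)); rewrite /err /=.
  field; exact: lt0r_neq0 (phi0 x xab).
- move=> x xab; apply: cvgM; last exact: cG.
  by apply: cvgB; [exact: cbphi|exact: cvg_cst].
- move=> x xab; apply: cvgM.
    apply: (@continuous_comp R R R (phase n m) (bump_prim e f)).
      exact: phase_continuous.
    exact: is_derive_continuous (is_derive_bump_prim e0 ef f4 _).
  apply: cvgD.
    apply: cvgM; first exact: cG.
    apply: cvgM; first by apply: cvgN; exact: phase_deriv2_continuous.
    apply: cvgV; first by rewrite expf_neq0 // gt_eqF ?phi0.
    apply: (@continuous_comp R R R (phase_deriv n m) (fun y => y ^+ 2)).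
      exact: phase_deriv_continuous.
    exact: exprn_continuous.
  by apply: cvgM; [exact: cphi|exact: cG'].
- by apply: bndT; rewrite lexx ltW.
- by apply: bndT; rewrite lexx ltW.
- move=> x xab; rewrite /err normrM ler_pM //; first exact: bump_prim_bound.
  have [ax xb] := andP xab; have x1 : 1 < x by lra.
  apply: (le_trans (ler_normD _ _)); apply: lerD.
    rewrite normrM -[K ^+ 2 / t]mul1r ler_pM // ?G1 //.
    rewrite normrM normrN normfV normrX (gtr0_norm (phi0 x xab)) -exprVn.
    (* The second derivative costs a factor [n.+1%:R] more than [P], while dividing by
       [phase_deriv ^+ 2] gains [P ^+ 2]; the surplus [n.+1%:R / P x] is at most [1 / t]. *)
    apply: (@le_trans _ _ (n.+1%:R * P x * (K / P x) ^+ 2)).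
      rewrite ler_pM ?exprn_ge0 ?invr_ge0 ?(ltW (phi0 x xab)) //.
        exact: phase_deriv2_bound.
      rewrite lerXn2r ?nnegrE ?invr_ge0 ?(ltW (phi0 x xab)) ?invphi //.
      by rewrite divr_ge0 // ltW // P0.
    have -> : n.+1%:R * P x * (K / P x) ^+ 2 = K ^+ 2 * (n.+1%:R / P x).
      by field; rewrite lt0r_neq0 // P0.
    rewrite ler_wpM2l ?exprn_ge0 ?(ltW K0) // ler_pdivrMr ?P0 //.
    by rewrite mulrC ler_pdivlMr // Pt.
  rewrite normrM gtr0_norm ?invr_gt0 ?phi0 //.
  have xl0 : 0 < x ^+ l by rewrite exprn_gt0; lra.
  have h1 : `|G' x| <= D * P x / t.
    rewrite ler_pdivlMr //; apply: le_trans (G'b x xab).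
    by rewrite ler_wpM2l // lerXn2r // nnegrE; lra.
  apply: (@le_trans _ _ (K / P x * (D * P x / t))).
    by rewrite ler_pM ?invr_ge0 ?(ltW (phi0 x xab)) ?invphi.
  by rewrite le_eqVlt; apply/orP; left; apply/eqP; field; rewrite !lt0r_neq0 // P0.
(* [1] and [D] are both at most [1 + D], which brings all terms under one constant. *)
rewrite /ortho_const -/K ler_pdivlMr //.
have -> : (2 * (K / t) *+ 2 + 2 * (K ^+ 2 / t + D * K / t) * (b - a)) * t =
   4 * K + 2 * (K ^+ 2 + D * K) * (b - a) by field; rewrite lt0r_neq0.
have h : 0 <= K ^+ 2 by rewrite exprn_ge0 // ltW.
move: (K ^+ 2) h => K2 h.
have : 0 <= D * K by rewrite mulr_ge0 // ltW.
have h2 : 0 <= D * K2 by rewrite mulr_ge0.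
move=> h3; have ba : 0 <= b - a by lra.
have : 0 <= (K + D * K2) * (b - a) by rewrite mulr_ge0 // addr_ge0 // ltW.
nra.
Qed.

End Orthogonality.

(** * Variance of the smoothed pair count *)

Section Variance.
Context {R : realType}.

Lemma sum_window (n c L : nat) :
  (\sum_(m < n) ((c <= m) && (m < c + L)) = minn (n - c) L)%N.
Proof.
elim: n => [|n IH]; first by rewrite big_ord0 sub0n min0n.
by rewrite big_ord_recr /= IH; case: (boolP ((c <= n) && (n < c + L))%N); lia.
Qed.

(** The exceptional indices met below lie in a short window: at the start of a row, at its end, or
    around a given row. Only the length of the window enters the estimates. *)
Lemma sum_window_le (n c L : nat) (P : pred nat) :
  (forall m, (m < n)%N -> P m -> (c <= m < c + L)%N) ->
  \sum_(m < n) (P m)%:R <= L%:R :> R.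
Proof.
move=> Pw; rewrite -natr_sum ler_nat.
apply: leq_trans (geq_minr (n - c) L); rewrite -sum_window; apply: leq_sum => m _.
by have := Pw m (ltn_ord m); case: (P m) => // ->.
Qed.

Lemma sum_lt_le (n L : nat) : \sum_(m < n) (m < L)%N%:R <= L%:R :> R.
Proof. by apply: (@sum_window_le n 0 L (fun k => k < L)%N) => k; lia. Qed.

Lemma sum_close_le (n L : nat) : \sum_(m < n) (n < m + L)%N%:R <= L%:R :> R.
Proof. by apply: (@sum_window_le n (n - L) L (fun k => n < k + L)%N) => k; lia. Qed.

Lemma sum_near_le (N n L : nat) :
  \sum_(k < N) ((n < k + L) && (k < n + L))%N%:R <= (L * 2)%:R :> R.
Proof.
by apply: (@sum_window_le N (n - L) (L * 2) (fun k => (n < k + L) && (k < n + L))%N) => k; lia.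
Qed.

Variables a b e f : R.
Hypotheses (a1 : 1 < a) (ab : a < b) (e0 : 0 < e) (ef : e < f) (f12 : f < 1 / 12).

Let f4 : f < 1 / 4. Proof. by have := f12; lra. Qed.
Let I := segint a b.
Let Y (n m : nat) (x : R) := bump e f (phase n m x).
(** The wider bump of [bump_mul_le]; [f < 1 / 12] keeps its outer radius [3 * f] below [1 / 4]. *)
Let U (n m : nat) (x : R) := bump (2 * f) (3 * f) (phase n m x).
Let mu := e + f.

(** The orthogonality bound with [D = 2 / (f - e)], the bound on the slope of the bump, and a gap of
    [L] between top exponents. *)
Definition ortho_err (L : nat) : R := ortho_const a b * (1 + 2 / (f - e)) / a ^+ L.
Local Notation kappa := ortho_err.

Let d0 : 0 < f - e. Proof. by rewrite subr_gt0. Qed.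
Let u1 : 0 < 2 * f. Proof. by have := e0; have := ef; lra. Qed.
Let u2 : 2 * f < 3 * f. Proof. by have := e0; have := ef; lra. Qed.
Let u3 : 3 * f < 1 / 4. Proof. by have := f12; lra. Qed.

Let kappa_ge0 L : 0 <= kappa L.
Proof.
have a0 : 0 <= a by have := a1; lra.
by rewrite /kappa !mulr_ge0 ?invr_ge0 ?exprn_ge0 ?ortho_const_ge0 ?addr_ge0 ?divr_ge0 ?(ltW d0).
Qed.

Lemma bump_phase_continuous e' f' n m : 0 < e' -> e' < f' -> f' < 1 / 4 ->
  continuous (fun x : R => bump e' f' (phase n m x)).
Proof.
move=> ? ? ? x; apply: (@continuous_comp R R R (phase n m) (bump e' f')).
  exact: phase_continuous.
exact: bump_continuous.
Qed.

Let cY n m : continuous (Y n m). Proof. exact: bump_phase_continuous. Qed.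
Let cU n m : continuous (U n m). Proof. exact: bump_phase_continuous. Qed.
Let cst_cont (c : R) : continuous (fun _ : R => c). Proof. by move=> x; exact: cvg_cst. Qed.
Let mul_cont (g h : R -> R) : continuous g -> continuous h -> continuous (fun x => g x * h x).
Proof. by move=> cg ch x; apply: cvgM; [exact: cg|exact: ch]. Qed.
Let add_cont (g h : R -> R) : continuous g -> continuous h -> continuous (fun x => g x + h x).
Proof. by move=> cg ch x; apply: cvgD; [exact: cg|exact: ch]. Qed.

Let Y01 n m x : 0 <= Y n m x <= 1. Proof. exact: bump_bounds. Qed.

Let segint_shift (g : R -> R) (c : R) : continuous g ->
  I g = I (fun x => g x - c) + c * (b - a).
Proof.
move=> cg; rewrite /I -(segint_cst ab) -segintD //; last exact: add_cont.
by congr segint; apply/funext => x; rewrite subrK.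
Qed.

(** Orthogonality against the constant [1], with [D = 0]. The radii are free so that the wider bump
    is covered too, and the bound is weakened to [kappa L] so that a single error serves
    everywhere. *)
Lemma mean_bump_phase e' f' (n m L : nat) : 0 < e' -> e' < f' -> f' < 1 / 4 ->
  (m < n)%N -> (L <= n)%N ->
  I (fun x => bump e' f' (phase n m x)) <= (e' + f') * (b - a) + kappa L.
Proof.
move=> e'0 ef' f'4 mn Ln.
have H := @bump_phase_orthogonal R a b e' f' 0 n m L (cst 1) (cst 0) a1 ab e'0 ef' f'4
  (lexx 0) mn Ln (fun x => is_derive_cst (1 : R) x (1 : R)) (@cst_cont 0).
rewrite (segint_shift (e' + f')); last exact: bump_phase_continuous.
rewrite addrC lerD2l; apply: le_trans (ler_norm _) _.
have -> : (fun x => bump e' f' (phase n m x) - (e' + f')) =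
  (fun x => (bump e' f' (phase n m x) - (e' + f')) * cst 1 x).
  by apply/funext => x; rewrite mulr1.
apply: (le_trans (H _ _)).
- by move=> x _; rewrite normr1.
- by move=> x _; rewrite normr0 !mul0r.
rewrite addr0 mulr1 /kappa -mulrA ler_wpM2l ?ortho_const_ge0 //.
have a0 : 0 < a by have := a1; lra.
rewrite ler_peMl ?invr_ge0 ?exprn_ge0 ?(ltW a0) // lerDl divr_ge0 // ltW //.
Qed.

(** Here [G] is the second bump shifted by [c]. By the chain rule [G'] has size at most
    [2 / (f' - e')] times [phase_deriv n' m'], and the gap [n' + L <= n] supplies the factor
    [x ^+ L] of slowness. The shift is [mu] for covariances and [0] for the wider bump. *)
Lemma cov_bump_phase e' f' c (n m n' m' L : nat) : 0 < e' -> e' < f' -> f' < 1 / 4 ->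
  f - e <= f' - e' -> 0 <= c <= 1 ->
  (m < n)%N -> (m' < n')%N -> (n' + L <= n)%N ->
  `|I (fun x => (Y n m x - mu) * (bump e' f' (phase n' m' x) - c))| <= kappa L.
Proof.
move=> e'0 ef' f'4 dd c01 mn mn' nL.
have d'0 : 0 < f' - e' by rewrite subr_gt0.
have D0 : 0 <= 2 / (f' - e') by rewrite divr_ge0 // ltW.
have Ln : (L <= n)%N := leq_trans (leq_addl _ _) nL.
have cphi : continuous (fun x => bump_deriv e' f' (phase n' m' x)).
  move=> x; apply: (@continuous_comp R R R (phase n' m') (bump_deriv e' f')).
    exact: phase_continuous.
  exact: bump_deriv_continuous.
apply: (le_trans (@bump_phase_orthogonal R a b e f (2 / (f' - e')) n m L
  (fun x => bump e' f' (phase n' m' x) - c)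
  (fun x => bump_deriv e' f' (phase n' m' x) * phase_deriv n' m' x)
  a1 ab e0 ef f4 D0 mn Ln _ _ _ _)).
- move=> x; have d1 := @is_derive1_comp _ (bump e' f') (phase n' m') x _ _
    (is_derive_bump e'0 ef' f'4 (phase n' m' x)) (is_derive_phase n' m' x).
  by apply: (is_derive_eq (is_derive_sub d1 (is_derive_cst c x (1 : R)))); rewrite subr0.
- by apply: mul_cont => //; exact: phase_deriv_continuous.
- move=> x _; have := bump_bounds e'0 ef' f'4 (phase n' m' x); rewrite ler_norml; lra.
- move=> x /andP[ax xb]; have a1' := a1; have x1 : 1 < x by lra.
  rewrite normrM -mulrA ler_pM ?mulr_ge0 ?exprn_ge0 //; first by lra.
    exact: bump_deriv_bound.
  rewrite ger0_norm ?phase_deriv_ge0 //.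
  apply: (@le_trans _ _ (n'.+1%:R * x ^+ n' * x ^+ L)).
    by rewrite ler_wpM2r ?exprn_ge0 ?phase_deriv_le //; lra.
  rewrite -mulrA -exprD ler_pM ?exprn_ge0 ?ler_nat ?ltnS ?ler_eXn2l //; first by lra.
  exact: leq_trans (leq_addr _ _) nL.
have a0 : 0 < a by have := a1; lra.
rewrite /kappa ler_wpM2r ?invr_ge0 ?exprn_ge0 ?(ltW a0) //.
rewrite ler_wpM2l ?ortho_const_ge0 // lerD2l ler_wpM2l // lef_pV2 // posrE.
Qed.

Let mu01 : 0 <= mu <= 1.
Proof. by have := e0; have := ef; have := f12; rewrite /mu; lra. Qed.

(** The phases [(n, m)] and [(n, m')] differ by the phase [(m', m)], whose top exponent is at least
    [L] lower. So [bump_mul_le] replaces the second factor by a wider bump of lower frequency,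
    nearly uncorrelated with the first. The product of the means is at most [2 * f * (5 * f)]. *)
Lemma cov_same_row (n m m' L : nat) : (m < m')%N -> (L <= m')%N ->
  (m' + L <= n)%N ->
  I (fun x => Y n m x * Y n m' x) <= 10 * f ^+ 2 * (b - a) + 2 * kappa L.
Proof.
move=> mm' Lm' m'L.
have m'n : (m' <= n)%N := leq_trans (leq_addr _ _) m'L.
have mn : (m < n)%N := leq_trans mm' m'n.
apply: (@le_trans _ _ (I (fun x => Y n m x * U m' m x))).
  apply: le_segint; [exact: mul_cont|exact: mul_cont|] => x _.
  have -> : U m' m x = bump (2 * f) (3 * f) (phase n m x - phase n m' x).
    by rewrite /U; congr bump; rewrite /phase; ring.
  exact: bump_mul_le.
have -> : (fun x => Y n m x * U m' m x) = (fun x => (Y n m x - mu) * (U m' m x - 0) + mu * U m' m x).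
  by apply/funext => x; ring.
rewrite /I segintD ?segintZ //; last 2 first.
- by apply: mul_cont => //; apply: add_cont.
- exact: mul_cont.
have h1 : I (fun x => (Y n m x - mu) * (U m' m x - 0)) <= kappa L.
  apply: le_trans (ler_norm _) _; apply: cov_bump_phase => //.
  - by have := e0; lra.
  - by rewrite lexx ler01.
have h2 : I (U m' m) <= (2 * f + 3 * f) * (b - a) + kappa L.
  exact: mean_bump_phase.
have := kappa_ge0 L; have := e0; have := ef; have := f12; have ba : 0 < b - a by rewrite subr_gt0.
rewrite -/I /mu; move: (I (U m' m)) h2 => B h2; move: (I _) h1 => A h1.
move: (kappa L) h1 h2 => K h1 h2 f12' ef' e0' K0.
have h3 : (e + f) * B <= (e + f) * ((2 * f + 3 * f) * (b - a) + K) by rewrite ler_wpM2l //; lra.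
have h4 : (e + f) * K <= K by rewrite ler_piMl //; lra.
have h5 : (e + f) * ((2 * f + 3 * f) * (b - a)) <= (2 * f) * ((2 * f + 3 * f) * (b - a)).
  by rewrite ler_wpM2r ?mulr_ge0 //; lra.
lra.
Qed.

Lemma mean_row_sqr (n L : nat) : (0 < L)%N -> (L <= n)%N ->
  I (fun x => (\sum_(m < n) Y n m x) ^+ 2) <=
    n%:R ^+ 2 * (10 * f ^+ 2 * (b - a) + 2 * kappa L) +
    5 * n%:R * L%:R * (2 * f * (b - a) + kappa L).
Proof.
move=> L0 Ln; set p := _ + 2 * _; set q := _ + kappa L.
have ba : 0 < b - a by rewrite subr_gt0.
have f0 : 0 < f := lt_trans e0 ef.
have ba' := ltW ba; have f0' := ltW f0.
have p0 : 0 <= p by apply: addr_ge0; [apply: mulr_ge0 => //; apply: mulr_ge0 => //; exact: exprn_ge0|apply: mulr_ge0].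
have q0 : 0 <= q by apply: addr_ge0 => //; apply: mulr_ge0 => //; apply: mulr_ge0.
under eq_fun do rewrite expr2 big_distrlr /=.
rewrite /I (segint_sum ab); last by move=> i; apply: continuous_bigsum => j; apply: mul_cont.
have single (m m' : 'I_n) : I (fun x => Y n m x * Y n m' x) <= q.
  apply: (@le_trans _ _ (I (Y n m))).
    apply: le_segint => // [|x _]; first exact: mul_cont.
    have /andP[? ?] := Y01 n m x; have /andP[? ?] := Y01 n m' x.
    by rewrite ler_piMr.
  apply: (le_trans (@mean_bump_phase e f n m L e0 ef f4 (ltn_ord m) Ln)).
  by rewrite lerD2r ler_wpM2r ?(ltW ba) //; have := ef; lra.
(* [cov_same_row] covers all pairs except those on the diagonal or with an index within [L] of an
   end of the row. Each of these five conditions charges [q] to at most [n * L] pairs, whence the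
   factor [5]. *)
have bnd (m m' : 'I_n) : I (fun x => Y n m x * Y n m' x) <=
    p + q * ((m == m')%:R + (m < L)%N%:R + (n < m + L)%N%:R + ((m' < L)%N%:R + (n < m' + L)%N%:R)).
  case: (boolP [|| m == m', (m < L)%N, (n < m + L)%N, (m' < L)%N | (n < m' + L)%N]) => h.
    apply: (le_trans (single m m')).
    have : 1 <= (m == m')%:R + (m < L)%N%:R + (n < m + L)%N%:R +
        ((m' < L)%N%:R + (n < m' + L)%N%:R) :> R.
      rewrite -!natrD ler1n; move: h.
      by case: (m == m') (m < L)%N (n < m + L)%N (m' < L)%N (n < m' + L)%N => [] [] [] [] [].
    by move=> h1; rewrite -[X in X <= _](add0r q) lerD // ler_peMr.
  move: h; rewrite !negb_or -!leqNgt => /and5P[h1 h2 h3 h4 h5].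
  rewrite (negbTE h1) (ltnNge m) h2 (ltnNge n) h3 (ltnNge m') h4 (ltnNge n) h5 /= !addr0 mulr0 addr0.
  have := h1; rewrite -val_eqE neq_ltn => /orP[lt|lt]; first exact: cov_same_row.
  by under eq_fun do rewrite mulrC; exact: cov_same_row.
apply: (@le_trans _ _ (\sum_(m < n) (n%:R * p + q * (1 + n%:R * (m < L)%N%:R + n%:R * (n < m + L)%N%:R + (L%:R + L%:R))))).
  apply: ler_sum => m _; rewrite (segint_sum ab); last by move=> j; apply: mul_cont.
  apply: (le_trans (ler_sum _ (fun m' _ => bnd m m'))).
  rewrite big_split /= sumr_const card_ord -[p *+ n]mulr_natl lerD2l -mulr_sumr ler_wpM2l //.
  rewrite !big_split /= !sumr_const card_ord.
  rewrite -[(m < L)%N%:R *+ n]mulr_natl -[(n < m + L)%N%:R *+ n]mulr_natl.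
  rewrite !lerD //.
  - rewrite (bigD1 m) //= eqxx big1 ?addr0 // => i /negbTE; rewrite eq_sym => -> //.
  - exact: sum_lt_le.
  - exact: sum_close_le.
rewrite big_split /= sumr_const card_ord -mulr_sumr !big_split /= -!mulr_sumr !sumr_const card_ord.
have w1 := sum_lt_le n L; have w2 := sum_close_le n L.
rewrite -[L%:R *+ n]mulr_natl -[(_ * p) *+ n]mulr_natl; move: w1 w2.
have nR : 0 <= n%:R :> R by [].
have LR : 1 <= L%:R :> R by rewrite ler1n.
move: (\sum_(m < n) _) (\sum_(m < n) _) (n%:R : R) (L%:R : R) nR LR => w w' nn LL nn0 LL1 ww ww'.
have -> : nn ^+ 2 * p + 5 * nn * LL * q = nn * (nn * p) + q * (nn * LL + nn * LL + nn * LL + (nn * LL + nn * LL)) by ring.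
rewrite lerD2l ler_wpM2l // !lerD ?mulr_ge0 // ?ler_wpM2l //; nra.
Qed.

Let S (n : nat) (x : R) := \sum_(m < n) (Y n m x - mu).

Let cZ n m : continuous (fun x => Y n m x - mu).
Proof. by apply: add_cont. Qed.
Let cS n : continuous (S n). Proof. by apply: continuous_bigsum. Qed.

(** The three summands come from the trivial bound for rows [n < L], from twice [mean_row_sqr], and
    from twice the square of the subtracted mean, where [n%:R * mu <= 2 * (N%:R * f)]. *)
Definition row_bound (N L : nat) : R :=
  L%:R ^+ 2 * (b - a) +
  2 * (N%:R ^+ 2 * (10 * f ^+ 2 * (b - a) + 2 * kappa L) +
       5 * N%:R * L%:R * (2 * f * (b - a) + kappa L)) +
  8 * (N%:R * f) ^+ 2 * (b - a).

Lemma row_sqr_le (n N L : nat) : (0 < L)%N -> (n < N)%N ->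
  I (fun x => S n x ^+ 2) <= row_bound N L.
Proof.
move=> L0 nN; rewrite /row_bound.
have ba : 0 < b - a by rewrite subr_gt0.
have f0 : 0 < f := lt_trans e0 ef.
have ba' := ltW ba; have f0' := ltW f0.
have q0 : 0 <= 2 * f * (b - a) + kappa L by apply: addr_ge0 => //; apply: mulr_ge0 => //; apply: mulr_ge0.
have p0 : 0 <= 10 * f ^+ 2 * (b - a) + 2 * kappa L.
  by apply: addr_ge0; [apply: mulr_ge0 => //; apply: mulr_ge0 => //; exact: exprn_ge0|apply: mulr_ge0].
have N0 : 0 <= 8 * (N%:R * f) ^+ 2 * (b - a).
  by apply: mulr_ge0 => //; apply: mulr_ge0 => //; apply: exprn_ge0; apply: mulr_ge0.
have L20 : 0 <= L%:R ^+ 2 * (b - a) by apply: mulr_ge0 => //; apply: exprn_ge0.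
have cS2 : continuous (fun x => S n x ^+ 2).
  by under eq_fun do rewrite expr2; apply: mul_cont.
have [nL|Ln] := ltnP n L.
  apply: (@le_trans _ _ (L%:R ^+ 2 * (b - a))).
    rewrite -(segint_cst ab); apply: le_segint => // x _.
    rewrite -[S n x ^+ 2]real_normK ?num_real // lerXn2r ?nnegrE //.
    apply: (le_trans (ler_norm_sum _ _ _)).
    apply: (@le_trans _ _ (\sum_(m < n) 1)).
      apply: ler_sum => m _; have := Y01 n m x; have := mu01; rewrite ler_norml; lra.
    by rewrite sumr_const card_ord ler_nat ltnW.
  have c0 : 0 <= 5 * N%:R * L%:R :> R by apply: mulr_ge0 => //; apply: mulr_ge0.
  rewrite -addrA lerDl; apply: addr_ge0 => //; apply: mulr_ge0 => //.
  by apply: addr_ge0; apply: mulr_ge0 => //; apply: exprn_ge0.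
have nN' : n%:R <= N%:R :> R by rewrite ler_nat ltnW.
have cA : continuous (fun x => \sum_(m < n) Y n m x) by apply: continuous_bigsum.
have cA2 : continuous (fun x => (\sum_(m < n) Y n m x) ^+ 2).
  by under eq_fun do rewrite expr2; apply: mul_cont.
apply: (@le_trans _ _ (I (fun x => 2 * (\sum_(m < n) Y n m x) ^+ 2 + 8 * (N%:R * f) ^+ 2))).
  apply: le_segint => //; first by apply: add_cont => //; apply: mul_cont.
  move=> x _; rewrite /S sumrB sumr_const card_ord -[mu *+ n]mulr_natl.
  have h1 : 0 <= n%:R * mu by rewrite mulr_ge0 //; case/andP: mu01.
  have h2 : n%:R * mu <= 2 * (N%:R * f).
    rewrite mulrCA ler_pM //; first by case/andP: mu01.
    by have := ef; rewrite /mu; lra.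
  have h3 : (n%:R * mu) ^+ 2 <= (2 * (N%:R * f)) ^+ 2 by rewrite lerXn2r // nnegrE (le_trans h1).
  move: (\sum_(m < n) _) (n%:R * mu) (N%:R * f) h3 => A B C h3.
  have -> : (A - B) ^+ 2 = 2 * A ^+ 2 + 2 * B ^+ 2 - (A + B) ^+ 2 by ring.
  have := sqr_ge0 (A + B); rewrite exprMn in h3; lra.
rewrite /I segintD //; last by apply: mul_cont.
rewrite segintZ // (segint_cst ab) // lerD2r.
rewrite -[X in X <= _](add0r) lerD // ler_wpM2l //.
apply: (le_trans (mean_row_sqr L0 Ln)); rewrite lerD //.
  by rewrite ler_wpM2r // lerXn2r ?nnegrE.
by rewrite ler_wpM2r // ler_wpM2r // ler_wpM2l.
Qed.

(** Expanding both rows gives at most [N ^ 2] covariances, each across a gap of at least [L] between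
    top exponents. *)
Lemma cov_rows_far (n n' N L : nat) : (n < N)%N -> (n' < N)%N -> (n' + L <= n)%N ->
  I (fun x => S n x * S n' x) <= N%:R ^+ 2 * kappa L.
Proof.
move=> nN n'N nL.
rewrite /S; under eq_fun do rewrite big_distrlr /=.
rewrite /I (segint_sum ab); last by move=> i; apply: continuous_bigsum => j; apply: mul_cont.
apply: (@le_trans _ _ (\sum_(m < n) \sum_(m' < n') kappa L)).
  apply: ler_sum => m _; rewrite (segint_sum ab); last by move=> j; apply: mul_cont.
  apply: ler_sum => m' _; apply: le_trans (ler_norm _) _.
  exact: cov_bump_phase.
rewrite !sumr_const !card_ord -mulrnA -[kappa L *+ _]mulr_natl natrM ler_wpM2r //.
by rewrite expr2 ler_pM // ler_nat ltnW.
Qed.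

(* Rows at distance at least [L] are uncorrelated; the others are controlled by
   [2 S_n S_n' <= S_n ^ 2 + S_n' ^ 2]. *)
Lemma variance_le (N L : nat) : (0 < L)%N ->
  I (fun x => (\sum_(n < N) S n x) ^+ 2) <=
    N%:R ^+ 4 * kappa L + 2 * N%:R * L%:R * row_bound N L.
Proof.
move=> L0; under eq_fun do rewrite expr2 big_distrlr /=.
rewrite /I (segint_sum ab); last by move=> i; apply: continuous_bigsum => j; apply: mul_cont.
have [->|N0] := posnP N.
  by rewrite big_ord0 expr0n /= mulr0 !mul0r addr0.
have B0 : 0 <= row_bound N L.
  by apply: le_trans (row_sqr_le L0 N0); apply: segint_ge0 => x _; apply: sqr_ge0.
have bnd (n n' : 'I_N) : I (fun x => S n x * S n' x) <=
    N%:R ^+ 2 * kappa L + row_bound N L * ((n < n' + L) && (n' < n + L))%N%:R.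
  have K0 : 0 <= N%:R ^+ 2 * kappa L by rewrite mulr_ge0 ?exprn_ge0.
  have [h1|h1] := leqP (n' + L) n; first by rewrite mulr0 addr0 cov_rows_far.
  have [h2|h2] := leqP (n + L) n'.
    under eq_fun do rewrite mulrC.
    by rewrite mulr0 addr0 cov_rows_far.
  rewrite mulr1; apply: (@le_trans _ _ (row_bound N L)); last by rewrite lerDr.
  apply: (@le_trans _ _ (I (fun x => 2^-1 * (S n x ^+ 2) + 2^-1 * (S n' x ^+ 2)))).
    have cS2 k : continuous (fun x => 2^-1 * (S k x ^+ 2)).
      by apply: mul_cont => //; under eq_fun do rewrite expr2; apply: mul_cont.
    apply: le_segint; [exact: mul_cont|exact: add_cont|move=> x _].
    have := sqr_ge0 (S n x - S n' x); move: (S n x) (S n' x) => u w; nra.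
  have cS2 k : continuous (fun x => S k x ^+ 2).
    by under eq_fun do rewrite expr2; apply: mul_cont.
  rewrite /I segintD ?segintZ //; try by apply: mul_cont.
  have := row_sqr_le L0 (ltn_ord n); have := row_sqr_le L0 (ltn_ord n'); rewrite /I; lra.
(* A given row has at most [2 * L] rows near it. *)
apply: (@le_trans _ _ (\sum_(n < N) (N%:R * (N%:R ^+ 2 * kappa L) + row_bound N L * (L%:R *+ 2)))).
  apply: ler_sum => n _; rewrite (segint_sum ab); last by move=> j; apply: mul_cont.
  apply: (le_trans (ler_sum _ (fun n' _ => bnd n n'))).
  rewrite big_split /= sumr_const card_ord -[_ *+ N]mulr_natl lerD2l -mulr_sumr ler_wpM2l //.
  rewrite -mulrnA.
  exact: sum_near_le.
rewrite sumr_const card_ord -mulr_natl -[L%:R *+ 2]mulr_natl.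
rewrite le_eqVlt; apply/orP; left; apply/eqP; ring.
Qed.

End Variance.

(** * Almost everywhere convergence from summable integrals *)

Section AlmostEverywhere.
Context {R : realType}.

(** [a ^+ k] is [expR (k%:R * ln a)], and one term of the exponential series is enough. *)
Lemma expn_le_geometric (a : R) (p : nat) : 1 < a ->
  exists2 M : R, 0 <= M & forall k : nat, k%:R ^+ p.+1 <= M * a ^+ k.
Proof.
move=> a1; have la0 : 0 < ln a by exact: ln_gt0.
exists (p.+1`!%:R / ln a ^+ p.+1).
  by rewrite divr_ge0 // exprn_ge0 // ltW.
move=> k; have -> : a ^+ k = expR (k%:R * ln a).
  by rewrite expRM_natl lnK // posrE; lra.
have x0 : 0 <= k%:R * ln a by rewrite mulr_ge0 // ltW.
have h := expR_ge1Dxn p x0.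
have F0 : 0 < p.+1`!%:R :> R by rewrite ltr0n fact_gt0.
have -> : k%:R ^+ p.+1 = p.+1`!%:R / ln a ^+ p.+1 * ((k%:R * ln a) ^+ p.+1 / p.+1`!%:R) :> R.
  by rewrite exprMn; field; rewrite ?gt_eqF // ?exprn_gt0.
rewrite ler_wpM2l ?divr_ge0 ?exprn_ge0 ?(ltW la0) //.
by apply: le_trans h; rewrite lerDr.
Qed.

Lemma sum_inv_sqr_le (n : nat) : \sum_(0 <= i < n) (i.+1%:R ^+ 2)^-1 <= 2 :> R.
Proof.
(* Strengthened by a telescoping term so that induction goes through. *)
have : \sum_(0 <= i < n) (i.+1%:R ^+ 2)^-1 <= 2 - 2 / n.+1%:R :> R.
  elim: n => [|n IH]; first by rewrite big_geq // divr1 subrr.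
  rewrite big_nat_recr //=; apply: (le_trans (lerD IH (lexx _))).
  have n0 : 0 <= n%:R :> R by [].
  rewrite -natr1 -[n.+2%:R]natr1 -[n.+1%:R]natr1; move: (n%:R : R) n0 => x x0.
  rewrite -subr_ge0.
  have -> : 2 - 2 / (x + 1 + 1) - (2 - 2 / (x + 1) + (((x + 1)) ^+ 2)^-1) =
    x / ((x + 1) ^+ 2 * (x + 1 + 1)).
    by field; apply/andP; split; apply: lt0r_neq0; lra.
  by rewrite divr_ge0 // mulr_ge0 ?exprn_ge0 //; lra.
move=> /le_trans; apply; rewrite gerBl //.
Qed.

(** By monotone convergence the series of the [h k] has a finite integral, so it converges almost
    everywhere on the segment and its terms tend to [0]. *)
Lemma ae_cvg0_of_sum_segint (a b C : R) (h : nat -> R -> R) : a < b ->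
  (forall k, continuous (h k)) -> (forall k x, 0 <= h k x) ->
  (forall n, \sum_(0 <= k < n) segint a b (h k) <= C) ->
  {ae @lebesgue_measure R, forall x : R, a <= x <= b -> h k x @[k --> \oo] --> (0 : R)}.
Proof.
move=> ab ch h0 hC.
pose mu : {measure set (measurableTypeR R) -> \bar R} := @lebesgue_measure R.
have ih k : mu.-integrable `[a, b] (EFin \o h k).
  by apply: segment_integrable => x _; apply: ch.
have mh k := measurable_int _ (ih k).
have int : mu.-integrable `[a, b] (fun x => \sum_(k <oo) (h k x)%:E)%E.
  apply/integrableP; split.
    apply: (@ge0_emeasurable_sum _ _ _ _ (fun k x => (h k x)%:E) predT).
      by move=> k x _ _; rewrite lee_fin.
    by move=> k _; exact: mh.
  have -> : (\int[mu]_(x in `[a, b]) `|\sum_(k <oo) (h k x)%:E| =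
    \int[mu]_(x in `[a, b]) (\sum_(k <oo) (h k x)%:E))%E.
    by apply: eq_integral => x _; rewrite gee0_abs // nneseries_ge0 // => k _ _; rewrite lee_fin.
  rewrite integral_nneseries //; last by move=> k x _; rewrite lee_fin.
  apply: (@le_lt_trans _ _ C%:E); last exact: ltry.
  apply: lime_le.
    by apply: is_cvg_nneseries => k _ _; apply: integral_ge0 => x _; rewrite lee_fin.
  apply: nearW => n.
  have -> : (\sum_(0 <= k < n) \int[mu]_(x in `[a, b]) (h k x)%:E =
    (\sum_(0 <= k < n) segint a b (h k))%:E)%E.
    rewrite -sumEFin; apply: eq_bigr => k _.
    by rewrite /segint /Rintegral fineK // (integrable_fin_num _ (ih k)).
  by rewrite lee_fin.
have A : {ae mu, forall x, `[a, b]%classic x -> (\sum_(k <oo) (h k x)%:E)%E \is a fin_num}.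
  exact: integrable_ae.
have [Z [mZ Z0 sZ]] := A.
exists Z; split => // x nP; apply: sZ => H; apply: nP => xab.
have {}H := H _; rewrite /= in_itv /= in H.
have fin := H xab.
apply: cvg_series_cvg_0; apply: nondecreasing_is_cvgn.
  by apply: nondecreasing_series => k _ _.
exists (fine (\sum_(k <oo) (h k x)%:E)%E) => _ [n _ <-].
rewrite -lee_fin fineK // /series /= -sumEFin.
by apply: nneseries_lim_ge => k _ _; rewrite lee_fin.
Qed.

End AlmostEverywhere.

(** * The smoothed count along sixth powers *)

Section SmoothedCount.
Context {R : realType}.
Implicit Types a b s t x : R.

Definition smooth_sum s t (N : nat) x : R :=
  \sum_(n < N) \sum_(m < n) (bump (s / N%:R) (t / N%:R) (phase n m x) - (s / N%:R + t / N%:R)).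

Lemma smooth_sum_continuous s t (N : nat) : 0 < s / N%:R -> s / N%:R < t / N%:R ->
  t / N%:R < 1 / 4 -> continuous (smooth_sum s t N).
Proof.
move=> e0 ef f4; apply: continuous_bigsum => n; apply: continuous_bigsum => m x.
by apply: cvgB; [exact: bump_phase_continuous|exact: cvg_cst].
Qed.

Lemma smooth_sum_variance a b s t : 1 < a -> a < b -> 0 < s -> s < t ->
  exists2 C : R, 0 <= C & forall k : nat, (0 < k)%N -> t / (k ^ 6)%:R < 1 / 12 ->
  segint a b (fun x => (smooth_sum s t (k ^ 6) x / (k ^ 6)%:R) ^+ 2) <= C / k%:R ^+ 2.
Proof.
move=> a1 ab s0 st.
(* The exponent is [20 = 14 + 6]: the error must absorb a factor [k ^ 14], and [1 / (f - e)]
   contributes [N = k ^ 6]. *)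
have [M M0 HM] := expn_le_geometric 19 a1.
set w := b - a; have w0 : 0 < w by rewrite subr_gt0.
have d0 : 0 < t - s by rewrite subr_gt0.
pose c1 := ortho_const a b * (1 + 2 / (t - s)).
have c10 : 0 <= c1.
  by rewrite mulr_ge0 ?ortho_const_ge0 // addr_ge0 // divr_ge0 // ltW.
pose c3 := c1 * M; have c30 : 0 <= c3 by rewrite mulr_ge0.
pose c4 := w + 28 * t ^+ 2 * w + 20 * t * w + 14 * c3.
have t0 : 0 < t := lt_trans s0 st.
have c40 : 0 <= c4.
  have w0' := ltW w0; have t0' := ltW t0.
  by repeat first [done|apply: addr_ge0|apply: mulr_ge0|apply: exprn_ge0].
exists (c3 + 2 * c4); first by rewrite addr_ge0 // mulr_ge0.
move=> k k0 tk12.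
set N := (k ^ 6)%N in tk12 *.
have NE : N%:R = k%:R ^+ 6 :> R by rewrite /N natrX.
have K1 : 1 <= k%:R :> R by rewrite ler1n.
have K0 : 0 < k%:R :> R by lra.
have N1 : 1 <= N%:R :> R by rewrite NE exprn_ege1.
have N0 : 0 < N%:R :> R by lra.
have e0 : 0 < s / N%:R by rewrite divr_gt0.
have ef : s / N%:R < t / N%:R by rewrite ltr_pM2r // invr_gt0.
have V := variance_le a1 ab e0 ef tk12 N k0.
have cS : continuous (fun x => smooth_sum s t N x ^+ 2).
  have c : continuous (smooth_sum s t N) by apply: smooth_sum_continuous => //; lra.
  by under eq_fun do rewrite expr2; move=> x; apply: cvgM; apply: c.
have -> : (fun x => (smooth_sum s t N x / N%:R) ^+ 2) =
  (fun x => (N%:R ^+ 2)^-1 * smooth_sum s t N x ^+ 2).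
  by apply/funext => x; rewrite exprMn exprVn mulrC.
rewrite segintZ //.
have {}V : segint a b (fun x => smooth_sum s t N x ^+ 2) <=
  N%:R ^+ 4 * ortho_err a b (s / N%:R) (t / N%:R) k +
  2 * N%:R * k%:R * row_bound a b (s / N%:R) (t / N%:R) N k by exact: V.
rewrite mulrC ler_pdivrMr ?exprn_gt0 //; apply: (le_trans V).
set kap := ortho_err _ _ _ _ _; rewrite /row_bound -/kap -/w.
have kap0 : 0 <= kap.
  rewrite /kap /ortho_err mulr_ge0 ?invr_ge0 ?exprn_ge0 //; last by lra.
  rewrite mulr_ge0 ?ortho_const_ge0 // addr_ge0 // divr_ge0 // subr_ge0 ltW //.
have kapb : kap * k%:R ^+ 14 <= c3.
  have a0 : 0 < a ^+ k by rewrite exprn_gt0 //; lra.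
  have h1 : kap <= c1 * N%:R / a ^+ k.
    rewrite /kap /ortho_err ler_wpM2r ?invr_ge0 ?(ltW a0) // /c1 -mulrA.
    rewrite ler_wpM2l ?ortho_const_ge0 //.
    have -> : 2 / (t / N%:R - s / N%:R) = 2 / (t - s) * N%:R.
      by field; rewrite !lt0r_neq0 //=; lra.
    by rewrite [X in _ <= X]mulrDl mul1r lerD2r.
  apply: (@le_trans _ _ (c1 * N%:R / a ^+ k * k%:R ^+ 14)).
    by rewrite ler_wpM2r // exprn_ge0 // ltW.
  have -> : c1 * N%:R / a ^+ k * k%:R ^+ 14 = c1 * (k%:R ^+ 20 / a ^+ k).
    by rewrite NE; field; rewrite lt0r_neq0.
  by rewrite /c3 ler_wpM2l // ler_pdivrMr.
have tN : N%:R * (t / N%:R) = t by rewrite mulrC divfK // lt0r_neq0.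
(* The row bound is of order [k ^ 2], because [N * (t / N) = t] and the errors weighted by
   [N ^ 2 = k ^ 12] and [N * k = k ^ 7] stay bounded. *)
have hB : k%:R ^+ 2 * w + 2 * (N%:R ^+ 2 * (10 * (t / N%:R) ^+ 2 * w + 2 * kap) +
    5 * N%:R * k%:R * (2 * (t / N%:R) * w + kap)) + 8 * (N%:R * (t / N%:R)) ^+ 2 * w <=
    c4 * k%:R ^+ 2.
  have -> : k%:R ^+ 2 * w + 2 * (N%:R ^+ 2 * (10 * (t / N%:R) ^+ 2 * w + 2 * kap) +
    5 * N%:R * k%:R * (2 * (t / N%:R) * w + kap)) + 8 * (N%:R * (t / N%:R)) ^+ 2 * w =
    w * k%:R ^+ 2 + 28 * t ^+ 2 * w + 20 * t * w * k%:R + 4 * (kap * k%:R ^+ 12) + 10 * (kap * k%:R ^+ 7).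
    by rewrite NE; field; rewrite lt0r_neq0.
  have l12 : kap * k%:R ^+ 12 <= c3.
    by apply: le_trans kapb; rewrite ler_wpM2l // ler_weXn2l.
  have l7 : kap * k%:R ^+ 7 <= c3.
    by apply: le_trans kapb; rewrite ler_wpM2l // ler_weXn2l.
  have k2 : 1 <= k%:R ^+ 2 :> R by rewrite exprn_ege1.
  have k1 : k%:R <= k%:R ^+ 2 :> R by rewrite -[X in X <= _]expr1 ler_weXn2l.
  have tw0 : 0 <= 28 * t ^+ 2 * w.
    by have w0' := ltW w0; repeat first [done|apply: mulr_ge0|apply: exprn_ge0|exact: ltW].
  have tw1 : 0 <= 20 * t * w.
    by have w0' := ltW w0; repeat first [done|apply: mulr_ge0|exact: ltW].
  have m1 := ler_peMr tw0 k2; have m2 := ler_wpM2l tw1 k1; have m3 := ler_peMr c30 k2.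
  have -> : c4 * k%:R ^+ 2 = w * k%:R ^+ 2 + 28 * t ^+ 2 * w * k%:R ^+ 2 +
      20 * t * w * k%:R ^+ 2 + 14 * (c3 * k%:R ^+ 2) by rewrite /c4; ring.
  move: l12 l7 m1 m2 m3.
  move: (28 * _ * w) (20 * t * w) (kap * _ ^+ 12) (kap * _ ^+ 7) => A B X Z *.
  lra.
(* The two parts have orders [k ^ 10] and [N * k * k ^ 2 = k ^ 9], against the allowed
   [N ^ 2 / k ^ 2 = k ^ 10]. *)
apply: (@le_trans _ _ (c3 * k%:R ^+ 10 + 2 * N%:R * k%:R * (c4 * k%:R ^+ 2))).
  apply: lerD.
    have -> : N%:R ^+ 4 * kap = kap * k%:R ^+ 14 * k%:R ^+ 10 by rewrite NE; ring.
    by rewrite ler_wpM2r // exprn_ge0.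
  by rewrite ler_wpM2l // mulr_ge0 // mulr_ge0.
have -> : (c3 + 2 * c4) / k%:R ^+ 2 * N%:R ^+ 2 = c3 * k%:R ^+ 10 + 2 * c4 * k%:R ^+ 10.
  by rewrite NE; field; rewrite lt0r_neq0.
rewrite lerD2l; have -> : 2 * N%:R * k%:R * (c4 * k%:R ^+ 2) = 2 * c4 * k%:R ^+ 9.
  by rewrite NE; ring.
by rewrite ler_wpM2l ?mulr_ge0 // ler_weXn2l.
Qed.

Lemma div_sixth_lt t d : 0 < t -> 0 < d ->
  exists k0 : nat, forall k : nat, (k0 < k)%N -> t / (k ^ 6)%:R < d.
Proof.
move=> t0 d0; exists (Num.bound (t / d)) => k k0k.
have h1 : t / d < (Num.bound (t / d))%:R by apply: archi_boundP; rewrite divr_ge0 // ltW.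
have h2 : (Num.bound (t / d))%:R <= k%:R :> R by rewrite ler_nat ltnW.
have h3 : k%:R <= (k ^ 6)%:R :> R.
  by rewrite ler_nat -[X in (X <= _)%N]expn1 leq_pexp2l // (leq_trans _ k0k).
have k6 : 0 < (k ^ 6)%:R :> R by rewrite ltr0n expn_gt0 (leq_trans _ k0k).
rewrite ltr_pdivrMr // mulrC -ltr_pdivrMr //; lra.
Qed.

Lemma smooth_sum_ae a b s t : 1 < a -> a < b -> 0 < s -> s < t ->
  {ae @lebesgue_measure R, forall x : R, a <= x <= b ->
    smooth_sum s t (k ^ 6) x / (k ^ 6)%:R @[k --> \oo] --> (0 : R)}.
Proof.
move=> a1 ab s0 st.
have [C C0 HC] := smooth_sum_variance a1 ab s0 st.
have t0 : 0 < t := lt_trans s0 st.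
have [k1 k1P] : exists k1 : nat, forall k : nat, (k1 < k)%N -> t / (k ^ 6)%:R < 1 / 12.
  by apply: div_sixth_lt; lra.
(* Shifting by a positive [k0] makes every bump narrow enough and keeps [k + k0] nonzero. *)
pose k0 := k1.+1.
have k0P (k : nat) : (k0 <= k)%N -> t / (k ^ 6)%:R < 1 / 12 by exact: k1P.
pose h k x := (smooth_sum s t ((k + k0) ^ 6) x / ((k + k0) ^ 6)%:R) ^+ 2.
have ch k : continuous (h k).
  have tk := k0P (k + k0)%N (leq_addl _ _).
  have N0 : 0 < ((k + k0) ^ 6)%:R :> R by rewrite ltr0n expn_gt0 addnS.
  have c : continuous (fun x => smooth_sum s t ((k + k0) ^ 6) x / ((k + k0) ^ 6)%:R).
    move=> x; apply: cvgM; last exact: cvg_cst.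
    apply: smooth_sum_continuous; first by rewrite divr_gt0.
      by rewrite ltr_pM2r // invr_gt0.
    by lra.
  by rewrite /h; under eq_fun do rewrite expr2; move=> x; apply: cvgM; apply: c.
have [||Z [mZ Z0 sZ]] := @ae_cvg0_of_sum_segint R a b (C * 2) h ab ch.
- by move=> k x; rewrite /h sqr_ge0.
- move=> n; apply: le_trans (ler_wpM2l C0 (sum_inv_sqr_le n)).
  rewrite mulr_sumr; apply: ler_sum => k _.
  have kk : (0 < k + k0)%N by rewrite addnS.
  apply: (le_trans (HC (k + k0)%N kk (k0P _ (leq_addl _ _)))).
  rewrite ler_wpM2l // lef_pV2 ?posrE ?exprn_gt0 ?ltr0n //.
  by rewrite lerXn2r ?nnegrE // ler_nat addnS ltnS leq_addr.
exists Z; split => // x nP; apply: sZ => H; apply: nP => xab.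
rewrite -(cvg_shiftn k0); apply/cvgr0Pnorm_lt => eps eps0.
have e20 : 0 < eps ^+ 2 by rewrite exprn_gt0.
have /cvgr0Pnorm_lt /(_ _ e20) := H xab.
apply: filterS => k; rewrite /h ger0_norm ?sqr_ge0 //=.
rewrite -[X in X < _ -> _]real_normK ?num_real //.
by rewrite ltr_pXn2r ?nnegrE ?(ltW eps0).
Qed.

End SmoothedCount.

(** * Comparison of the pair count with sums of bumps *)

Section CountingPairs.
Context {R : realType}.
Implicit Types (x y r s t : R) (N : nat).

(** Induction on [N]: a new index adds a row and a column, equal by symmetry, and a diagonal entry
    that is excluded. *)
Lemma card_sym_pairs N (c : nat -> nat -> bool) : (forall i j, c i j = c j i) ->
  #|[pred p : 'I_N * 'I_N | (p.1 != p.2) && c p.1 p.2]| =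
  (2 * \sum_(n < N) \sum_(m < n) c m n)%N.
Proof.
move=> cC; pose g (i j : nat) : nat := (i != j) && c i j.
have -> : #|[pred p : 'I_N * 'I_N | (p.1 != p.2) && c p.1 p.2]| =
    (\sum_(i < N) \sum_(j < N) g i j)%N.
  rewrite -sum1_card big_mkcond pair_big /=; apply: eq_bigr => p _.
  by rewrite inE /g val_eqE; case: ifP.
elim: N => [|N IH]; first by rewrite !big_ord0.
rewrite big_ord_recr /= [in RHS]big_ord_recr /= mulnDr -IH.
under eq_bigr do rewrite big_ord_recr /=.
rewrite big_split /= -addnA; congr addn.
rewrite [X in (_ + X)%N]big_ord_recr /= {3}/g eqxx /= addn0 mul2n -addnn.
congr addn; apply: eq_bigr => m _; rewrite /g.
  by rewrite ltn_eqF.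
by rewrite gtn_eqF // cC.
Qed.

Lemma dist_int_le y r (m : int) : `|y - m%:~R| <= r -> dist_int y <= r.
Proof.
move=> ymr; apply: le_trans ymr; apply: ge_inf; last by exists m.
by exists 0 => _ [k _ <-].
Qed.

(** Strictness spares showing that the infimum is attained; this is why [close_le_bump] asks for
    [r < e]. *)
Lemma dist_int_lt y r : dist_int y < r -> exists m : int, `|y - m%:~R| < r.
Proof.
move=> /inf_lt[]; first by exists `|y - 0%:~R|, 0.
by move=> _ [m _ <-] ?; exists m.
Qed.

Lemma dist_int_opp y : dist_int (- y) = dist_int y.
Proof.
have H (z : R) : range (fun m : int => `|- z - m%:~R|) `<=` range (fun m : int => `|z - m%:~R|).
  by move=> _ [m _ <-]; exists (- m) => //; rewrite -normrN intrN; congr `|_|; ring.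
rewrite /dist_int; congr inf; apply/seteqP; split; first exact: H.
by have := @H (- y); rewrite opprK.
Qed.

Definition close x r (m n : nat) : bool :=
  dist_int (frac_part (x ^+ n.+1) - frac_part (x ^+ m.+1)) <= r.

Lemma closeC x r m n : close x r m n = close x r n m.
Proof. by rewrite /close -dist_int_opp opprB. Qed.

Definition close_count x r N : nat := \sum_(n < N) \sum_(m < n) close x r m n.

Lemma close_pairsE x s N :
  close_pairs (fun n => frac_part (x ^+ n)) s N = (2 * close_count x (s / N%:R) N)%N.
Proof. by rewrite -card_sym_pairs //; exact: closeC. Qed.

Lemma close_count_le x r N N' : (N <= N')%N -> (close_count x r N <= close_count x r N')%N.
Proof.
by move=> NN'; rewrite /close_count -(subnKC NN') big_split_ord /= leq_addr.
Qed.

(** Passing to fractional parts moves a difference by an integer, which the periodic bump does not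
    see. *)
Lemma frac_part_sub y z : exists q : int, frac_part y - frac_part z = y - z - q%:~R.
Proof. by exists (Num.floor y - Num.floor z); rewrite /frac_part intrB; ring. Qed.

Variables e f : R.
Hypotheses (e0 : 0 < e) (ef : e < f) (f4 : f < 1 / 4).

Lemma close_le_bump x r m n : r < e -> (close x r m n)%:R <= bump e f (phase n m x).
Proof.
move=> re; have /andP[b0 _] := bump_bounds e0 ef f4 (phase n m x).
case: (boolP (close x r m n)) => [|_]; last exact: b0.
rewrite /close => h; have [m' hm] := dist_int_lt (le_lt_trans h re).
have [q hq] := frac_part_sub (x ^+ n.+1) (x ^+ m.+1).
rewrite (@bump_eq1 _ _ _ e0 ef f4 (q + m')) //.
by move: hm; rewrite hq -addrA -opprD -intrD => /ltW.
Qed.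

Lemma bump_le_close x r m n : f <= r -> bump e f (phase n m x) <= (close x r m n)%:R.
Proof.
move=> fr; have /andP[_ b1] := bump_bounds e0 ef f4 (phase n m x).
case: (boolP (close x r m n)) => [_|nc]; first exact: b1.
have [->//|/bump_neq0] := eqVneq (bump e f (phase n m x)) 0.
move=> /(_ e0 ef f4)[m' hm]; case/negP: nc.
have [q hq] := frac_part_sub (x ^+ n.+1) (x ^+ m.+1).
apply: (@dist_int_le _ _ (m' - q)); rewrite hq intrB opprB addrA subrK.
exact: le_trans hm fr.
Qed.

End CountingPairs.

(** * Interpolation between sixth powers and between radii *)

Section Sandwich.
Context {R : realType}.
Implicit Types (x s t : R) (N : nat).

(** There are [N * (N - 1) / 2] pairs [m < n], each with mean [(s + t) / N]. *)
Lemma smooth_sumE s t N x : (0 < N)%N ->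
  \sum_(n < N) \sum_(m < n) bump (s / N%:R) (t / N%:R) (phase n m x) =
  smooth_sum s t N x + (s + t) * (N%:R - 1) / 2.
Proof.
move=> N0; have Nn0 : N%:R != 0 :> R by rewrite pnatr_eq0 -lt0n.
have H : forall M : nat, \sum_(n < M) \sum_(m < n) (s / N%:R + t / N%:R) =
    (s / N%:R + t / N%:R) * (M%:R * (M%:R - 1)) / 2 :> R.
  elim=> [|M IH]; first by rewrite big_ord0 !mul0r mulr0 mul0r.
  rewrite big_ord_recr /= IH sumr_const card_ord -[_ *+ M]mulr_natl -natr1.
  by field.
rewrite /smooth_sum; under [X in _ = X + _]eq_bigr do rewrite sumrB.
rewrite sumrB H.
by field.
Qed.

(** [j.+1] is the integer part of the sixth root of [N], a maximum that exists because
    [k <= k ^ 6 <= N] bounds the search. *)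
Lemma near_sixth_root (Q : nat -> Prop) : (\forall j \near \oo, Q j) ->
  \forall N \near \oo, exists2 j : nat, Q j & (j.+1 ^ 6 <= N < j.+2 ^ 6)%N.
Proof.
move=> [J _ QJ]; exists (J.+1 ^ 6)%N => // N /= JN.
have exk : exists k : nat, (k ^ 6 <= N)%N by exists J.+1.
have bk k : (k ^ 6 <= N)%N -> (k <= N)%N.
  apply: leq_trans; case: k => // k.
  by rewrite -[X in (X <= _)%N]expn1 leq_pexp2l.
case: (ex_maxnP exk bk) => k kN kmax.
have Jk := kmax _ JN; case: k kN kmax Jk => // j kN kmax Jk.
exists j; first exact: QJ.
rewrite kN ltnNge; apply/negP => /kmax.
by rewrite ltnn.
Qed.

Let ratio (j : nat) : R := (1 + harmonic j) ^+ 6.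

Lemma ratioE (j : nat) : ratio j = (j.+2 ^ 6)%:R / (j.+1 ^ 6)%:R.
Proof.
rewrite /ratio /harmonic /= !natrX -[j.+2%:R]natr1 -exprVn -exprMn; congr (_ ^+ 6).
by rewrite mulrDl divff ?mul1r // pnatr_eq0.
Qed.

Lemma ratio_cvg : ratio j @[j --> \oo] --> (1 : R).
Proof.
have H : (1 + harmonic j : R) @[j --> \oo] --> (1 + 0 : R).
  by apply: cvgD; [exact: cvg_cst|exact: cvg_harmonic].
have H2 := continuous_cvg _ (@exprn_continuous R 6 (1 + 0)) H.
by rewrite addr0 expr1n in H2; exact: H2.
Qed.

Variable x : R.

Let X s t (k : nat) : R := smooth_sum s t (k ^ 6) x / (k ^ 6)%:R.

Lemma near_div_sixth_lt (t : R) c : 0 < t ->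
  \forall j \near \oo, t / ((j + c.+1) ^ 6)%:R < 1 / 4.
Proof.
move=> t0; have [k0 H] := @div_sixth_lt R t (1 / 4) t0 ltac:(lra).
by exists k0 => // j /= kj; apply: H; rewrite addnS ltnS (leq_trans kj) // leq_addr.
Qed.

(** The count up to [N] is at most that up to the next sixth power [M]. The radius [s / N] is below
    [s1 / M] once [ratio j * s < s1], and dividing by the smaller power instead of [N] costs a
    factor [ratio j], which tends to [1]. *)
Lemma count_upper (s s1 t1 eps : R) : 0 < s -> s < s1 -> s1 < t1 -> 0 < eps ->
  X s1 t1 k @[k --> \oo] --> (0 : R) ->
  \forall N \near \oo,
    (close_pairs (fun n => frac_part (x ^+ n)) s N)%:R / N%:R <= s1 + t1 + eps.
Proof.
move=> s0 ss1 st1 eps0 cX.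
have cX2 : X s1 t1 (j + 2) @[j --> \oo] --> (0 : R) by rewrite (cvg_shiftn 2).
have cV : ratio j * (2 * X s1 t1 (j + 2) + (s1 + t1)) @[j --> \oo] --> (1 * (2 * 0 + (s1 + t1)) : R).
  apply: cvgM; first exact: ratio_cvg.
  by apply: cvgD; [apply: cvgM; [exact: cvg_cst|exact: cX2]|exact: cvg_cst].
have cs : ratio j * s @[j --> \oo] --> (1 * s : R).
  by apply: cvgM; [exact: ratio_cvg|exact: cvg_cst].
rewrite mulr0 add0r mul1r in cV; rewrite mul1r in cs.
have n1 : \forall j \near \oo, ratio j * (2 * X s1 t1 (j + 2) + (s1 + t1)) < s1 + t1 + eps.
  by apply: (cvgr_lt _ cV); rewrite ltrDl.
have n2 : \forall j \near \oo, ratio j * s < s1 by exact: (cvgr_lt _ cs).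
have n3 := @near_div_sixth_lt t1 1 ltac:(lra).
have : \forall j \near \oo, [/\ ratio j * (2 * X s1 t1 (j + 2) + (s1 + t1)) < s1 + t1 + eps,
    ratio j * s < s1 & t1 / ((j + 2) ^ 6)%:R < 1 / 4].
  by near=> j; split; near: j.
move=> /near_sixth_root; apply: filterS => N [j [h1 h2 h3] /andP[jN Nj]].
rewrite !addn2 in h1 h3; set M := (j.+2 ^ 6)%N in h1 h3 Nj *; set m0 := (j.+1 ^ 6)%N in jN.
have m0p : 0 < m0%:R :> R by rewrite ltr0n expn_gt0.
have Mp : 0 < M%:R :> R by rewrite ltr0n expn_gt0.
have Nm : m0%:R <= N%:R :> R by rewrite ler_nat.
have Np : 0 < N%:R :> R by apply: lt_le_trans Nm.
have rE : ratio j = M%:R / m0%:R by rewrite ratioE.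
have e0 : 0 < s1 / M%:R by rewrite divr_gt0 //; lra.
have ef : s1 / M%:R < t1 / M%:R by rewrite ltr_pM2r // invr_gt0.
have re : s / N%:R < s1 / M%:R.
  apply: (@le_lt_trans _ _ (s / m0%:R)).
    by rewrite ler_wpM2l ?(ltW s0) // lef_pV2.
  rewrite ltr_pdivlMr //; apply: le_lt_trans h2.
  by rewrite rE le_eqVlt; apply/orP; left; apply/eqP; field; rewrite lt0r_neq0.
rewrite close_pairsE natrM.
have c1 : (close_count x (s / N%:R) N)%:R <= smooth_sum s1 t1 M x + (s1 + t1) * (M%:R - 1) / 2.
  apply: (@le_trans _ _ (close_count x (s / N%:R) M)%:R).
    by rewrite ler_nat close_count_le // ltnW.
  rewrite -smooth_sumE; last by rewrite expn_gt0.
  rewrite /close_count natr_sum; apply: ler_sum => n _.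
  by rewrite natr_sum; apply: ler_sum => m _; apply: close_le_bump.
apply: le_trans (ltW h1).
set T := (close_count _ _ _)%:R in c1 *.
have T0 : 0 <= T by [].
have c2 : 2 * T <= 2 * smooth_sum s1 t1 M x + (s1 + t1) * M%:R by lra.
have -> : ratio j * (2 * X s1 t1 j.+2 + (s1 + t1)) =
    (2 * smooth_sum s1 t1 M x + (s1 + t1) * M%:R) / m0%:R.
  by rewrite rE /X -/M; field; rewrite !lt0r_neq0.
apply: (@le_trans _ _ (2 * T / m0%:R)).
  by rewrite ler_wpM2l ?mulr_ge0 // lef_pV2.
by rewrite ler_wpM2r // invr_ge0 ltW.
Unshelve. all: by end_near. Qed.

(** The mirror image of [count_upper]: count only up to the smaller sixth power [m0], with outer
    radius [t2 / m0 <= s / N], and divide by the larger power. *)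
Lemma count_lower (s s2 t2 eps : R) : 0 < s2 -> s2 < t2 -> t2 < s -> 0 < eps ->
  X s2 t2 k @[k --> \oo] --> (0 : R) ->
  \forall N \near \oo,
    s2 + t2 - eps <= (close_pairs (fun n => frac_part (x ^+ n)) s N)%:R / N%:R.
Proof.
move=> s0 st2 ts eps0 cX.
have cX1 : X s2 t2 (j + 1) @[j --> \oo] --> (0 : R) by rewrite (cvg_shiftn 1).
(* [1 - harmonic j ^+ 6] will be [(m0 - 1) / m0], the proportion left by the excluded diagonal. *)
have ch6 : harmonic j ^+ 6 @[j --> \oo] --> (0 : R).
  have H := continuous_cvg _ (@exprn_continuous R 6 0) (@cvg_harmonic R).
  by rewrite expr0n in H; exact: H.
have cV : (2 * X s2 t2 (j + 1) + (s2 + t2) * (1 - harmonic j ^+ 6)) / ratio j @[j --> \oo] -->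
    ((2 * 0 + (s2 + t2) * (1 - 0)) / 1 : R).
  apply: cvgM; last by apply: cvgV; [exact: oner_neq0|exact: ratio_cvg].
  apply: cvgD; first by apply: cvgM; [exact: cvg_cst|exact: cX1].
  by apply: cvgM; [exact: cvg_cst|apply: cvgB; [exact: cvg_cst|exact: ch6]].
have cs : ratio j * t2 @[j --> \oo] --> (1 * t2 : R).
  by apply: cvgM; [exact: ratio_cvg|exact: cvg_cst].
rewrite mulr0 add0r subr0 mulr1 divr1 in cV; rewrite mul1r in cs.
have n1 : \forall j \near \oo, s2 + t2 - eps <
    (2 * X s2 t2 (j + 1) + (s2 + t2) * (1 - harmonic j ^+ 6)) / ratio j.
  by apply: (cvgr_gt _ cV); rewrite ltrBlDr ltrDl.
have n2 : \forall j \near \oo, ratio j * t2 < s by exact: (cvgr_lt _ cs).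
have n3 := @near_div_sixth_lt t2 0 ltac:(lra).
have : \forall j \near \oo, [/\ s2 + t2 - eps <
      (2 * X s2 t2 (j + 1) + (s2 + t2) * (1 - harmonic j ^+ 6)) / ratio j,
    ratio j * t2 < s & t2 / ((j + 1) ^ 6)%:R < 1 / 4].
  by near=> j; split; near: j.
move=> /near_sixth_root; apply: filterS => N [j [h1 h2 h3] /andP[jN Nj]].
rewrite !addn1 in h1 h3; set M := (j.+2 ^ 6)%N in Nj; set m0 := (j.+1 ^ 6)%N in h1 h3 jN.
have m0p : 0 < m0%:R :> R by rewrite ltr0n expn_gt0.
have Mp : 0 < M%:R :> R by rewrite ltr0n expn_gt0.
have Nm : m0%:R <= N%:R :> R by rewrite ler_nat.
have NM : N%:R <= M%:R :> R by rewrite ler_nat ltnW.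
have Np : 0 < N%:R :> R by apply: lt_le_trans Nm.
have rE : ratio j = M%:R / m0%:R by rewrite ratioE.
have hE : harmonic j ^+ 6 = (m0%:R)^-1 :> R by rewrite /harmonic /= exprVn natrX.
have e0 : 0 < s2 / m0%:R by rewrite divr_gt0.
have ef : s2 / m0%:R < t2 / m0%:R by rewrite ltr_pM2r // invr_gt0.
have fr : t2 / m0%:R <= s / N%:R.
  apply: (@le_trans _ _ (s / M%:R)); last first.
    by rewrite ler_wpM2l ?lef_pV2 //; lra.
  rewrite ler_pdivlMr //; apply: le_trans (ltW h2).
  by rewrite rE le_eqVlt; apply/orP; left; apply/eqP; field; rewrite lt0r_neq0.
rewrite close_pairsE natrM.
have c1 : smooth_sum s2 t2 m0 x + (s2 + t2) * (m0%:R - 1) / 2 <= (close_count x (s / N%:R) N)%:R.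
  apply: (@le_trans _ _ (close_count x (s / N%:R) m0)%:R); last first.
    by rewrite ler_nat close_count_le.
  rewrite -smooth_sumE; last by rewrite expn_gt0.
  rewrite /close_count natr_sum; apply: ler_sum => n _.
  by rewrite natr_sum; apply: ler_sum => m _; apply: bump_le_close.
apply: (le_trans (ltW h1)).
set T := (close_count _ _ _)%:R in c1 *.
have T0 : 0 <= T by [].
have c2 : 2 * smooth_sum s2 t2 m0 x + (s2 + t2) * (m0%:R - 1) <= 2 * T by lra.
have -> : (2 * X s2 t2 j.+1 + (s2 + t2) * (1 - harmonic j ^+ 6)) / ratio j =
    (2 * smooth_sum s2 t2 m0 x + (s2 + t2) * (m0%:R - 1)) / M%:R.
  by rewrite rE hE /X -/m0; field; rewrite !lt0r_neq0.
apply: (@le_trans _ _ (2 * T / M%:R)).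
  by rewrite ler_wpM2r // invr_ge0 ltW.
by rewrite ler_wpM2l ?mulr_ge0 // lef_pV2.
Unshelve. all: by end_near. Qed.

(** Rational radii suffice by density, which leaves only countably many exceptional sets. *)
Lemma poissonian_of_smooth :
  (forall s t : rat, (0 : R) < ratr s -> ratr s < ratr t :> R ->
    X (ratr s) (ratr t) k @[k --> \oo] --> (0 : R)) ->
  poissonian_pair_correlations (fun n : nat => frac_part (x ^+ n)).
Proof.
move=> HX; split => [n _|s s0].
  rewrite /frac_part; have := floor_le (x ^+ n); have := floorD1_gt (x ^+ n).
  by rewrite intrD; lra.
apply/cvgrPdist_le => eps eps0.
(* [s1] and [t1] exceed [s] by less than [eps / 4], so [s1 + t1 + eps / 4] is within [eps] of
   [2 * s]; [s2] and [t2] do the same from below. *)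
have [s1 /[!in_itv]/= /andP[hs1 hs1']] := rat_in_itvoo (ltac:(lra) : s < s + eps / 4).
have [t1 /[!in_itv]/= /andP[ht1 ht1']] := rat_in_itvoo hs1'.
(* The truncation at [0] keeps [s2] positive when [s < eps / 4]. *)
pose l := Num.max 0 (s - eps / 4).
have l0 : 0 <= l by rewrite le_max lexx.
have l1 : s - eps / 4 <= l by rewrite le_max lexx orbT.
have ls : l < s by rewrite gt_max s0 /=; lra.
have [t2 /[!in_itv]/= /andP[ht2 ht2']] := rat_in_itvoo ls.
have [s2 /[!in_itv]/= /andP[hs2 hs2']] := rat_in_itvoo ht2.
have e4 : 0 < eps / 4 by lra.
have s20 : 0 < ratr s2 :> R := le_lt_trans l0 hs2.
have U := count_upper s0 hs1 ht1 e4 (HX _ _ (lt_trans s0 hs1) ht1).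
have V := count_lower s20 hs2' ht2' e4 (HX _ _ s20 hs2').
near=> N.
have u : (close_pairs (fun n => frac_part (x ^+ n)) s N)%:R / N%:R <=
  ratr s1 + ratr t1 + eps / 4 by near: N.
have v : ratr s2 + ratr t2 - eps / 4 <=
  (close_pairs (fun n => frac_part (x ^+ n)) s N)%:R / N%:R by near: N.
rewrite ler_norml; lra.
Unshelve. all: by end_near. Qed.

End Sandwich.

(** * Union of the countably many exceptional sets *)

Unset Implicit Arguments.

Theorem theorem1p2 (R : realType) :
  {ae (@lebesgue_measure R), forall x : R, 1 < x ->
    poissonian_pair_correlations (fun n : nat => frac_part (x ^+ n))}.
Proof.
(* A parameter is a segment number with a pair of rational radii; the segments
   [[1 + 1 / (j + 1), j + 3]] exhaust the half-line [x > 1]. *)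
pose good (p : nat * (rat * rat)) (x : R) : Prop :=
  (0 : R) < ratr p.2.1 -> ratr p.2.1 < ratr p.2.2 :> R ->
  1 + (p.1.+1%:R)^-1 <= x <= p.1.+3%:R ->
  smooth_sum (ratr p.2.1) (ratr p.2.2) (k ^ 6) x / (k ^ 6)%:R @[k --> \oo] --> (0 : R).
have ae_good p : {ae (@lebesgue_measure R), forall x : R, good p x}.
  have [s0|s0] := ltP (0 : R) (ratr p.2.1); last first.
    by apply: aeW => x; rewrite /good ltNge s0.
  have [st|st] := ltP (ratr p.2.1 : R) (ratr p.2.2); last first.
    by apply: aeW => x _; rewrite ltNge st.
  have i0 : 0 < (p.1.+1%:R)^-1 :> R by rewrite invr_gt0.
  have i1 : (p.1.+1%:R)^-1 <= 1 :> R by rewrite invf_le1 // ler1n.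
  have j3 : 3 <= p.1.+3%:R :> R by rewrite ler_nat.
  have a1 : 1 < 1 + (p.1.+1%:R)^-1 :> R by rewrite ltrDl.
  have ab : 1 + (p.1.+1%:R)^-1 < p.1.+3%:R :> R.
    move: (p.1.+1%:R^-1) i1 => i i1; lra.
  have [Z [mZ Z0 sZ]] := smooth_sum_ae a1 ab s0 st.
  by exists Z; split => // x nP; apply: sZ => H; apply: nP => _ _.
(* Parameters are enumerated by [unpickle]; codes that decode to nothing get the empty set. *)
pose bad (n : nat) : set R :=
  if unpickle n is Some p then ~` [set x | good p x] else set0.
have nbad n : (@lebesgue_measure R).-negligible (bad n).
  by rewrite /bad; case: unpickle => [p|]; [exact: ae_good|exact: negligible_set0].
have [Z [mZ Z0 sZ]] := negligible_bigcup nbad.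
exists Z; split => // x nP; apply: sZ; apply: contrapT => nbadx; apply: nP => x1.
apply: poissonian_of_smooth => s t s0 st.
have [j jx] : exists j : nat, 1 + (j.+1%:R)^-1 <= x <= j.+3%:R.
  (* The first bound yields [1 / (j + 1) <= x - 1], the second [x <= j + 3]. *)
  pose j := maxn (Num.bound (x - 1)^-1) (Num.bound x); exists j.
  have b1 : (x - 1)^-1 < (Num.bound (x - 1)^-1)%:R.
    by apply: archi_boundP; rewrite invr_ge0; lra.
  have b2 : x < (Num.bound x)%:R by apply: archi_boundP; lra.
  have b3 : (Num.bound (x - 1)^-1)%:R <= j.+1%:R :> R by rewrite ler_nat leqW // leq_maxl.
  have b4 : (Num.bound x)%:R <= j.+3%:R :> R by rewrite ler_nat !leqW // leq_maxr.
  have b5 : (j.+1%:R)^-1 <= x - 1.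
    by rewrite -[X in _ <= X]invrK lef_pV2 ?posrE ?invr_gt0 //; lra.
  by rewrite (le_trans (ltW b2) b4) andbT addrC -lerBrDr.
have g : good (j, (s, t)) x.
  apply: contrapT => ng; apply: nbadx; exists (pickle (j, (s, t))) => //.
  by rewrite /bad pickleK.
exact: (g s0 st jx).
Qed.
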